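(* Let $G \leq \mathrm{Homeo}(\mathfrak{C})$ be a finitely generated simple vigorous group. Then there exists $\sigma \in G$ of order $30$ such that for any nontrivial $\alpha \in G$ there exists $\beta \in \sigma^G$ such that $\langle \alpha, \beta \rangle = G$.
   Context: $\mathfrak{C}$ denotes Cantor space and $\mathrm{Homeo}(\mathfrak{C})$ its group of homeomorphisms, acting on the right. A group $G \leq \mathrm{Homeo}(\mathfrak{C})$ is vigorous if for every clopen subset $A$ of $\mathfrak{C}$ and all proper nonempty clopen subsets $B$ and $C$ of $A$ there exists $\gamma \in G$ such that $B\gamma \subseteq C$ and $\gamma$ fixes $\mathfrak{C} \setminus A$ pointwise. $\sigma^G$ denotes the conjugacy class of $\sigma$ in $G$. *)

(* Defs.v *)
From HB Require Import structures.
From mathcomp Require Import all_boot.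
From mathcomp Require Import boolp classical_sets functions cardinality.
From mathcomp Require Import topology cantor.

Set Implicit Arguments.
Unset Strict Implicit.
Unset Printing Implicit Defensive.

Local Open Scope classical_set_scope.

Record homeo (T : topologicalType) := Homeo {
  homeo_fun :> T -> T;
  homeo_inv : T -> T;
  homeo_funK : cancel homeo_fun homeo_inv;
  homeo_invK : cancel homeo_inv homeo_fun;
  homeo_continuous : continuous homeo_fun;
  homeo_inv_continuous : continuous homeo_inv }.

Section HomeoGroup.
Variable T : topologicalType.
Implicit Types f g h : homeo T.

Lemma homeo_ext f g : f =1 g -> f = g.
Proof.
case: f => f f' fK f'K cf cf'; case: g => g g' gK g'K cg cg' /= /funext fg.
case: _ / fg in gK g'K cg *.
have f'g' : f' = g' by apply: funext => x; rewrite -[RHS]fK g'K.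
case: _ / f'g' in gK g'K cg' *.
by congr Homeo; apply: Prop_irrelevance.
Qed.

HB.instance Definition _ := gen_eqMixin (homeo T).
HB.instance Definition _ := gen_choiceMixin (homeo T).

Definition homeo_one : homeo T :=
  @Homeo T id id (fun=> erefl) (fun=> erefl)
    (fun x => @cvg_id _ (nbhs x)) (fun x => @cvg_id _ (nbhs x)).

(* Homeomorphisms act on the right: x (f * g) = (x f) g. *)
Definition homeo_mul f g : homeo T :=
  @Homeo T (g \o f) (homeo_inv f \o homeo_inv g)
    (can_comp (@homeo_funK _ g) (@homeo_funK _ f))
    (can_comp (@homeo_invK _ f) (@homeo_invK _ g))
    (fun x => continuous_comp (@homeo_continuous _ f x)
                              (@homeo_continuous _ g (f x)))
    (fun x => continuous_comp (@homeo_inv_continuous _ g x)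
                              (@homeo_inv_continuous _ f (homeo_inv g x))).

Definition homeo_opp f : homeo T :=
  Homeo (@homeo_invK _ f) (@homeo_funK _ f)
    (@homeo_inv_continuous _ f) (@homeo_continuous _ f).

Fact homeo_mulA : associative homeo_mul.
Proof. by move=> f g h; apply: homeo_ext. Qed.

Fact homeo_mul1 : left_id homeo_one homeo_mul.
Proof. by move=> f; apply: homeo_ext. Qed.

Fact homeo_mulr1 : right_id homeo_one homeo_mul.
Proof. by move=> f; apply: homeo_ext. Qed.

Fact homeo_mulV : left_inverse homeo_one homeo_opp homeo_mul.
Proof. by move=> f; apply: homeo_ext => x /=; rewrite homeo_invK. Qed.

Fact homeo_mulrV : right_inverse homeo_one homeo_opp homeo_mul.
Proof. by move=> f; apply: homeo_ext => x /=; rewrite homeo_funK. Qed.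

HB.instance Definition _ := isGroup.Build (homeo T)
  homeo_mulA homeo_mul1 homeo_mulr1 homeo_mulV homeo_mulrV.

End HomeoGroup.

Section GroupNotions.
Local Open Scope group_scope.
Variable gT : groupType.
Implicit Types (G N A : set gT) (x y : gT).

Definition subgroup G : Prop := group_closed [in G].

Definition generated A : set gT := smallest subgroup A.

Definition finitely_generated G : Prop :=
  exists2 A, finite_set A & generated A = G.

Definition normal_subgroup N G : Prop :=
  [/\ subgroup N, N `<=` G & forall x y, N x -> G y -> N (x ^ y)].

Definition simple_group G : Prop :=
  G <> [set 1] /\
  forall N, normal_subgroup N G -> N = [set 1] \/ N = G.

Definition has_order x (n : nat) : Prop :=
  [/\ (0 < n)%N, x ^+ n = 1 &
      forall k : nat, (0 < k)%N -> x ^+ k = 1 -> (n <= k)%N].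

Definition conjugacy_class x G : set gT := [set x ^ y | y in G].

End GroupNotions.

Definition vigorous (G : set (homeo cantor_space)) : Prop :=
  forall A B C : set cantor_space,
    clopen A -> clopen B -> clopen C ->
    B !=set0 -> C !=set0 -> B `<` A -> C `<` A ->
    exists g : homeo cantor_space,
      [/\ G g, g @` B `<=` C & forall x, (~` A) x -> g x = x].

(* Main.v *)
(* Vigour and simplicity make G approximately full: any finite piecewise-G
   partial map between clopen sets extends to an element of G which is trivial
   off a slightly larger set.  Hence commutators of permutations of finitely
   many disjoint "tiles" are realised exactly, and G has elements of order 30
   of the form phi * kap * chi with disjoint supports: phi swaps eight tiles in
   pairs, kap is a 5-cycle of tiles, and chi acts by a fixed element c of order
   3 on each of four tiles.  Let alpha be nontrivial.  A conjugation places the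
   tiles of phi so that phi ^ alpha and kap permute the same nine tiles, four of
   which ("slots") carry chi; suitable words in phi ^ alpha and kap isolate the
   action of chi on each slot.  A further conjugation deforms chi on three of
   the slots.  On the first one it makes chi reach the whole rest of the space,
   so that finitely many commutators in one tile generate G with the help of
   the other elements at hand; on the other two it turns c into c ^ s and
   c ^ f, where s is a shift and f carries all the factors of these commutators
   on a sparse (Sidon) sequence of translates under s, from which they are
   recovered as commutators of conjugates of f. *)

Require Import Defs.
From mathcomp Require Import all_boot.
From mathcomp Require Import boolp classical_sets functions cardinality.
From mathcomp Require Import topology cantor.
From mathcomp Require Import zify.

Set Implicit Arguments.
Unset Strict Implicit.
Unset Printing Implicit Defensive.

Local Open Scope classical_set_scope.
Local Open Scope group_scope.

(** * Subgroups *)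

(** The element sigma is fixed before alpha is known, so everything specific to alpha must enter
    through the conjugator. The coprime orders 2, 5 and 3 let powers of beta recover the conjugates
    of [phi], [kap] and [chi]; the last conjugator [d] is supported away from the tiles of [phi] and
    [kap], so it deforms [chi] alone.

    One slot keeps [c] undeformed as a reference: dividing [c] by [c ^ s] or [c ^ f] on a common
    tile leaves [[~ c, s]] or [[~ c, f]]. Order 3 matters here. Both [[~ c, g]] and [[~ c^-1, g]]
    act as [g] on a piece [q], but their inverse copies of [g] lie on the images of [q] under [c]
    and [c^-1], which are disjoint. A commutator of one of each kind therefore sees only [q]; for an
    involution the two copies would coincide.

    A circularity has to be avoided: [f] encodes a finite list of generators, while generators
    obtained from beta seem to depend on [f]. Hence a generating set of G not mentioning [f] is
    exhibited first; finite generation of G extracts a finite list from it, and [f] is built from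
    that list. *)

Section Subgroups.
Variable gT : groupType.
Implicit Types (K S : set gT) (x y z : gT).

Lemma subgroup1 K : subgroup K -> K 1.
Proof. by case=> /set_mem. Qed.

Lemma subgroupF K x y : subgroup K -> K x -> K y -> K (x / y).
Proof. by case=> _ KF Kx Ky; apply/set_mem/KF; apply/mem_set. Qed.

Lemma subgroupV K x : subgroup K -> K x -> K x^-1.
Proof. by move=> sK Kx; rewrite -[x^-1]mul1g; apply: subgroupF (subgroup1 sK) Kx. Qed.

Lemma subgroupM K x y : subgroup K -> K x -> K y -> K (x * y).
Proof.
by move=> sK Kx Ky; rewrite -[y]invgK; apply: subgroupF => //; apply: subgroupV.
Qed.

Lemma subgroupJ K x y : subgroup K -> K x -> K y -> K (x ^ y).
Proof. by move=> sK Kx Ky; do !apply: subgroupM => //; apply: subgroupV. Qed.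

Lemma subgroupR K x y : subgroup K -> K x -> K y -> K [~ x, y].
Proof.
by move=> sK Kx Ky; apply: subgroupM; [|apply: subgroupV|apply: subgroupJ].
Qed.

Lemma subgroupX K x n : subgroup K -> K x -> K (x ^+ n).
Proof.
move=> sK Kx; elim: n => [|n IHn]; first by rewrite expg0; apply: subgroup1.
by rewrite expgS; apply: subgroupM.
Qed.

Lemma subgroup_intro K : K 1 -> (forall x y, K x -> K y -> K (x * y)) ->
  (forall x, K x -> K x^-1) -> subgroup K.
Proof.
move=> K1 KM KV; split; first exact/mem_set.
by move=> x y /set_mem Kx /set_mem Ky; apply/mem_set/KM => //; apply: KV.
Qed.

Lemma generated_subgroup S : subgroup (generated S).
Proof.
apply: subgroup_intro.
- by move=> K [sK _]; apply: subgroup1.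
- by move=> x y Sx Sy K KS; apply: subgroupM (proj1 KS) (Sx K KS) (Sy K KS).
- by move=> x Sx K KS; apply: subgroupV (proj1 KS) (Sx K KS).
Qed.

Lemma sub_generated S : S `<=` generated S.
Proof. exact: sub_gen_smallest. Qed.

Lemma generated_sub S K : subgroup K -> S `<=` K -> generated S `<=` K.
Proof. by move=> sK SK; apply: smallest_sub. Qed.

Lemma generatedS S S' : S `<=` S' -> generated S `<=` generated S'.
Proof.
move=> SS'; apply: generated_sub (@generated_subgroup S') _.
exact: subset_trans SS' (@sub_generated S').
Qed.

Lemma generated_seq S x : generated S x ->
  exists2 s : seq gT, {in s, forall y, S y} & generated [set` s] x.
Proof.
pose K := [set x | exists2 s : seq gT, {in s, forall y, S y} & generated [set` s] x].
have sK : subgroup K.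
  apply: subgroup_intro.
  - by exists [::] => //; apply: subgroup1 (@generated_subgroup _).
  - move=> y z [s Ss sy] [s' Ss' s'z]; exists (s ++ s') => [w|].
      by rewrite mem_cat => /orP[/Ss|/Ss'].
    apply: subgroupM (@generated_subgroup _) _ _.
      by apply: generatedS sy => w /=; rewrite mem_cat => ->.
    by apply: generatedS s'z => w /=; rewrite mem_cat => ->; rewrite orbT.
  - by move=> y [s Ss sy]; exists s => //; apply: subgroupV (@generated_subgroup _) _.
apply: (generated_sub sK) => y Sy; exists [:: y] => [z|].
  by rewrite inE => /eqP ->.
by apply: sub_generated => /=; rewrite inE.
Qed.

(** Each of finitely many generators is a word in finitely many elements of [S]. This lets the
    finite list be drawn from a prescribed infinite generating set. *)
Lemma finitely_generated_seq S : finitely_generated (generated S) ->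
  exists2 s : seq gT, {in s, forall y, S y} & generated S `<=` generated [set` s].
Proof.
case=> A /finite_seqP[t ->] tS.
have tSP x : x \in t -> generated S x by move=> xt; rewrite -tS; apply: sub_generated.
suff [s Ss ts]: exists2 s : seq gT, {in s, forall y, S y} & [set` t] `<=` generated [set` s].
  by exists s => //; rewrite -tS; apply: generated_sub (@generated_subgroup _) ts.
elim: t tSP {tS} => [|x t IHt] tSP; first by exists [::].
have [|s Ss ts] := IHt; first by move=> y yt; apply: tSP; rewrite inE yt orbT.
have [|s' Ss' xs'] := @generated_seq S x; first by apply: tSP; rewrite inE eqxx.
exists (s' ++ s) => [w|y /=].
  by rewrite mem_cat => /orP[/Ss'|/Ss].
rewrite inE => /orP[/eqP ->|yt].
  by apply: generatedS xs' => w /=; rewrite mem_cat => ->.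
by apply: generatedS (ts y yt) => w /=; rewrite mem_cat => ->; rewrite orbT.
Qed.

(** The subgroup generated by [S] is normal in [G] and nontrivial, hence equal to [G]. It serves
    both to spread a local property to all of [G] and to conclude generation from commutators of
    proper support. *)
Lemma simple_sub_conj_closed G S K : subgroup G -> simple_group G ->
  S `<=` G -> (forall x y, S x -> G y -> S (x ^ y)) ->
  (exists2 x, S x & x <> 1) -> subgroup K -> S `<=` K -> G `<=` K.
Proof.
move=> sG [_ simG] SG SJ [x Sx x1] sK SK.
have nS : normal_subgroup (generated S) G.
  split; [exact: generated_subgroup|exact: generated_sub|].
  move=> y z Sy Gz.
  suff : generated S `<=` [set u | generated S (u ^ z)] by apply.
  apply: generated_sub.
    have sgS := @generated_subgroup S.
    apply: subgroup_intro => /= [|u v|u].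
    - by rewrite conj1g; apply: subgroup1.
    - by rewrite conjMg; apply: subgroupM.
    - by rewrite conjVg; apply: subgroupV.
  by move=> u Su; apply: sub_generated; apply: SJ.
case: (simG _ nS) => [S1|<-]; last exact: generated_sub.
by have /= := sub_generated Sx; rewrite S1.
Qed.

(** The exponents are Chinese remainder idempotents: 15, 6 and 10 are 1 modulo 2, 5 and 3
    respectively, and 0 modulo the other two. *)
Lemma three_commuting_powers x y z : commute x y -> commute x z -> commute y z ->
  x ^+ 2 = 1 -> y ^+ 5 = 1 -> z ^+ 3 = 1 ->
  [/\ (x * y * z) ^+ 15 = x, (x * y * z) ^+ 6 = y,
      (x * y * z) ^+ 10 = z & (x * y * z) ^+ 30 = 1].
Proof.
move=> xy xz yz x2 y5 z3.
have cz : commute (x * y) z by apply/commute_sym/commuteM; apply/commute_sym.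
have pw n : (x * y * z) ^+ n = x ^+ n * y ^+ n * z ^+ n.
  by rewrite expgMn // expgMn.
have red (t : gT) d q r : t ^+ d = 1 -> t ^+ (d * q + r)%N = t ^+ r.
  by move=> td; rewrite expgnDr expgnA td expg1n mul1g.
rewrite !pw.
rewrite -[15]/(2 * 7 + 1)%N (red x 2) // -[(2 * 7 + 1)%N]/(5 * 3 + 0)%N (red y 5) //.
rewrite -[(5 * 3 + 0)%N]/(3 * 5 + 0)%N (red z 3) //.
rewrite -[6]/(2 * 3 + 0)%N (red x 2) // -[(2 * 3 + 0)%N]/(5 * 1 + 1)%N (red y 5) //.
rewrite -[(5 * 1 + 1)%N]/(3 * 2 + 0)%N (red z 3) //.
rewrite -[10]/(2 * 5 + 0)%N (red x 2) // -[(2 * 5 + 0)%N]/(5 * 2 + 0)%N (red y 5) //.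
rewrite -[(5 * 2 + 0)%N]/(3 * 3 + 1)%N (red z 3) //.
rewrite -[30]/(2 * 15 + 0)%N (red x 2) // -[(2 * 15 + 0)%N]/(5 * 6 + 0)%N (red y 5) //.
rewrite -[(5 * 6 + 0)%N]/(3 * 10 + 0)%N (red z 3) //.
by rewrite !expg0 !expg1 !mulg1 !mul1g.
Qed.

Lemma prime_power_eq1 x p k : prime p -> x <> 1 -> x ^+ p = 1 -> x ^+ k = 1 -> p %| k.
Proof.
move=> pp x1 xp xk; apply/negPn/negP; rewrite -prime_coprime // => cop.
case: (egcdnP k (prime_gt0 pp)) => u v e _; rewrite (eqP cop) in e.
apply: x1; have := expgnA x p u; rewrite xp expg1n mulnC e expgnDr expg1.
by rewrite mulnC expgnA xk expg1n mul1g.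
Qed.

Lemma has_order_30 x y z : commute x y -> commute x z -> commute y z ->
  x ^+ 2 = 1 -> y ^+ 5 = 1 -> z ^+ 3 = 1 -> x <> 1 -> y <> 1 -> z <> 1 ->
  has_order (x * y * z) 30.
Proof.
move=> xy xz yz x2 y5 z3 x1 y1 z1.
have [p15 p6 p10 p30] := three_commuting_powers xy xz yz x2 y5 z3.
split=> // k k0 pk.
have d t n : (x * y * z) ^+ n = t -> t ^+ k = 1.
  by move=> <-; rewrite -expgnA mulnC expgnA pk expg1n.
have d2 := prime_power_eq1 (isT : prime 2) x1 x2 (d _ _ p15).
have d5 := prime_power_eq1 (isT : prime 5) y1 y5 (d _ _ p6).
have d3 := prime_power_eq1 (isT : prime 3) z1 z3 (d _ _ p10).
apply: dvdn_leq => //; rewrite -[30]/(2 * 3 * 5)%N.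
by rewrite !Gauss_dvd // d2 d3 d5.
Qed.

End Subgroups.

(** * Homeomorphisms and supports *)

Lemma disjoint_mem (T : Type) (A B : set T) x : A `&` B = set0 -> A x -> B x -> False.
Proof. by move=> /predeqP/(_ x)[AB0 _] Ax Bx; apply: AB0. Qed.

Section HomeoAction.
Variable T : topologicalType.
Implicit Types (f g h : homeo T) (A B W : set T) (x y : T).

Lemma homeo1E x : (1 : homeo T) x = x.
Proof. by []. Qed.

Lemma homeoM f g x : (f * g) x = g (f x).
Proof. by []. Qed.

Lemma homeoK f x : f^-1 (f x) = x.
Proof. exact: homeo_funK. Qed.

Lemma homeoVK f x : f (f^-1 x) = x.
Proof. exact: homeo_invK. Qed.

Lemma homeoJ f g x : (f ^ g) x = g (f (g^-1 x)).
Proof. by []. Qed.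

Lemma homeoR f g x : [~ f, g] x = g (f (g^-1 (f^-1 x))).
Proof. by []. Qed.

Lemma homeo_inj f x y : f x = f y -> x = y.
Proof. by move=> fxy; rewrite -[x](homeoK f) fxy homeoK. Qed.

(* The image of [A] under [h], as a preimage so that membership computes. *)
Definition img h A : set T := [set y | A (h^-1 y)].

Lemma imgE h A x : img h A (h x) <-> A x.
Proof. by rewrite -[img h A (h x)]/(A (h^-1 (h x))) homeoK. Qed.

Lemma img1 A : img 1 A = A.
Proof. by []. Qed.

Lemma imgM f g A : img (f * g) A = img g (img f A).
Proof. by []. Qed.

Lemma imgK f A : img f^-1 (img f A) = A.
Proof. by rewrite -imgM mulgV img1. Qed.

Lemma imgKV f A : img f (img f^-1 A) = A.
Proof. by rewrite -imgM mulVg img1. Qed.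

Lemma imgU f A B : img f (A `|` B) = img f A `|` img f B.
Proof. by []. Qed.

Lemma imgP f A y : img f A y <-> exists2 x, A x & f x = y.
Proof.
split=> [Ay|[x Ax <-]]; last exact/imgE.
by exists (f^-1 y) => //; rewrite homeoVK.
Qed.

Lemma clopen_img h A : clopen A -> clopen (img h A).
Proof. by move=> cA; apply: preimage_clopen cA (@homeo_inv_continuous _ h). Qed.

Lemma clopenD A B : clopen A -> clopen B -> clopen (A `\` B).
Proof. by move=> cA cB; rewrite setDE; apply: clopenI cA (clopenC set0 cB). Qed.

Definition supported A h := forall x, ~ A x -> h x = x.

Lemma supportedS A B h : A `<=` B -> supported A h -> supported B h.
Proof. by move=> AB hA x Bx; apply: hA => /AB. Qed.

Lemma supported_mem A h x : supported A h -> A (h x) <-> A x.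
Proof.
move=> hA; split=> Ax; apply: contrapT => nAx.
  by apply: (nAx); rewrite (hA _ nAx) in Ax.
by apply: (nAx); rewrite (homeo_inj (hA _ nAx)).
Qed.

Lemma supportedV A h : supported A h -> supported A h^-1.
Proof. by move=> hA x Ax; rewrite -[in LHS](hA x Ax) homeoK. Qed.

Lemma supported_memV A h x : supported A h -> A (h^-1 x) <-> A x.
Proof. by move/supportedV; apply: supported_mem. Qed.

Lemma supportedM A f g : supported A f -> supported A g -> supported A (f * g).
Proof. by move=> fA gA x Ax; rewrite homeoM fA ?gA. Qed.

Lemma supportedX A f n : supported A f -> supported A (f ^+ n).
Proof.
by move=> fA; elim: n => [|n IHn]; rewrite ?expg0 // expgS; apply: supportedM.
Qed.

Lemma supportedJ A f g : supported A f -> supported (img g A) (f ^ g).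
Proof. by move=> fA x Ax; rewrite homeoJ fA // homeoVK. Qed.

Lemma supportedR A f g : supported A f -> supported A g -> supported A [~ f, g].
Proof.
move=> fA gA; apply: supportedM; first exact: supportedV.
by apply: supportedM; [apply: supportedV|apply: supportedM].
Qed.

Lemma img_supported A h : supported A h -> img h A = A.
Proof. by move=> hA; apply/predeqP => x; apply: supported_memV. Qed.

Lemma supported_conj A B f g : img g A `<=` B -> supported A f -> supported B (f ^ g).
Proof. by move=> AB fA; apply: supportedS AB _; apply: supportedJ. Qed.

Lemma supported_commute A B f g : supported A f -> supported B g ->
  (forall x, A x -> B x -> False) -> commute f g.
Proof.
move=> fA gB AB; apply: homeo_ext => x; rewrite !homeoM.
have [Ax|Ax] := pselect (A x).
  have Bx : ~ B x by move=> Bx; apply: (AB x).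
  rewrite (gB x) // gB // => /(AB (f x)); apply.
  exact/(supported_mem x fA).
rewrite (fA x) //.
have [Bx|Bx] := pselect (B x); last by rewrite !gB // fA.
by rewrite fA // => Agx; apply: (AB _ Agx); apply/(supported_mem x gB).
Qed.

Lemma supported_conj_eq A B f g : supported A f -> supported B g ->
  (forall x, A x -> B x -> False) -> f ^ g = f.
Proof.
move=> fA gB AB; apply/conjg_fixP/commgP; exact: supported_commute fA gB AB.
Qed.

Lemma conj_agree A f g h : supported A f -> (forall x, A x -> g x = h x) ->
  f ^ g = f ^ h.
Proof.
move=> fA gh; apply: homeo_ext => x; rewrite !homeoJ.
have [Ax|Ax] := pselect (A (g^-1 x)).
  have e : h^-1 x = g^-1 x by apply: (@homeo_inj h); rewrite homeoVK -gh // homeoVK.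
  by rewrite e; apply: gh; apply/(supported_mem _ fA).
have Ax' : ~ A (h^-1 x).
  by move=> Ahx; apply: Ax; rewrite -[x in g^-1 x](homeoVK h) -gh // homeoK.
by rewrite !fA // !homeoVK.
Qed.

(** Invariance of [W] under [f] is bundled with agreement, so that the relation passes to products,
    inverses and conjugates. *)
Definition agree_on W f g := forall x, (W (f x) <-> W x) /\ (W x -> f x = g x).

Lemma agree_on_refl W f : supported W f -> agree_on W f f.
Proof. by move=> fW x; split=> //; apply: supported_mem. Qed.

Lemma agree_onM W f f' g g' :
  agree_on W f f' -> agree_on W g g' -> agree_on W (f * g) (f' * g').
Proof.
move=> ff' gg' x; rewrite !homeoM; have [fx ffx] := ff' x; have [gx ggx] := gg' (f x).
split; first by rewrite gx fx.
by move=> Wx; rewrite -ffx // ggx //; apply/fx.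
Qed.

Lemma agree_onV W f f' : agree_on W f f' -> agree_on W f^-1 f'^-1.
Proof.
move=> ff' x; have [fx ffx] := ff' (f^-1 x); rewrite homeoVK in fx ffx.
split=> [|Wx]; first by split=> /fx.
by apply: (@homeo_inj f'); rewrite homeoVK -ffx ?homeoVK //; apply/fx.
Qed.

Lemma agree_onJ W f f' g g' :
  agree_on W f f' -> agree_on W g g' -> agree_on W (f ^ g) (f' ^ g').
Proof. by move=> ff' gg'; do !apply: agree_onM => //; apply: agree_onV. Qed.

Lemma agree_onX W f f' n : agree_on W f f' -> agree_on W (f ^+ n) (f' ^+ n).
Proof.
by move=> ff'; elim: n => [|n IHn]; rewrite ?expg0 ?expgS //; apply: agree_onM.
Qed.

Lemma agree_on_conj_eq W f g g' : supported W f -> agree_on W g g' -> f ^ g = f ^ g'.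
Proof. by move=> fW gg'; apply: conj_agree fW _ => x Wx; apply: (gg' x).2. Qed.

(* Off [W] the maps [f] and [g] have disjoint supports, hence commute. *)
Lemma commutator_supported W A B f g :
  (forall x, W (f x) <-> W x) -> (forall x, W (g x) <-> W x) ->
  supported A f -> supported B g -> A `&` B `<=` W -> supported W [~ f, g].
Proof.
move=> Wf Wg fA gB ABW.
suff fg x : ~ W x -> g (f x) = f (g x).
  move=> x Wx; rewrite homeoR fg ?homeoVK // => Wfgx; apply: Wx.
  by rewrite -(homeoVK f x); apply/Wf; rewrite -(homeoVK g (f^-1 x)); apply/Wg.
move=> Wx; have [Ax|Ax] := pselect (A x).
  have Bx : ~ B x by move=> Bx; apply: Wx; apply: ABW.
  have Bfx : ~ B (f x).
    move=> Bfx; apply: Wx; apply/Wf; apply: ABW; split=> //.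
    exact/(supported_mem _ fA).
  by rewrite (gB x) // gB.
rewrite (fA x) //.
have [Bx|Bx] := pselect (B x); last by rewrite !gB // fA.
rewrite fA // => Agx; apply: Wx; apply/Wg; apply: ABW; split=> //.
exact/(supported_mem _ gB).
Qed.

(** Whatever [f] and [g] do off [W] cancels in the commutator. This is the device by which
    uncontrolled parts of elements are discarded. *)
Lemma commutator_local W A B f g f' g' :
  agree_on W f f' -> agree_on W g g' -> supported W f' -> supported W g' ->
  supported A f -> supported B g -> A `&` B `<=` W ->
  [~ f, g] = [~ f', g'].
Proof.
move=> ff' gg' f'W g'W fA gB ABW; apply: homeo_ext => x.
have [Wx|Wx] := pselect (W x).
  have R : agree_on W [~ f, g] [~ f', g'].
    by apply: agree_onM; [apply: agree_onV|apply: agree_onJ].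
  exact: (R x).2.
rewrite (commutator_supported _ _ fA gB ABW) ?(supportedR f'W g'W) //.
- by move=> y; have [] := ff' y.
- by move=> y; have [] := gg' y.
Qed.

End HomeoAction.

(** * Clopen subsets of Cantor space and vigorous groups *)

Local Notation X := cantor_space.

Section CantorClopen.
Implicit Types (A B Q : set X) (x y : X).

Lemma clopen_avoid x (s : seq X) : x \notin s ->
  exists Q, [/\ clopen Q, Q x & forall y, y \in s -> ~ Q y].
Proof.
elim: s => [_|y s IHs]; first by exists setT; split=> //; apply: clopenT.
rewrite inE negb_or => /andP[xy /IHs[Q [cQ Qx Qs]]].
have [U [cU Ux Uy]] := cantor_zero_dimensional xy.
exists (Q `&` U); split=> //; first exact: clopenI.
by move=> z; rewrite inE => /orP[/eqP -> []|/Qs Qz []].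
Qed.

Lemma clopen_infinite A (s : seq X) : clopen A -> A !=set0 ->
  exists2 x, A x & x \notin s.
Proof.
elim: s A => [|y s IHs] A cA [x Ax]; first by exists x.
have [z Az zy] : exists2 z, A z & z != y.
  have [<-|xy] := eqVneq x y; last by exists x.
  have [_ /predeqP/(_ x)[_ /(_ I)]] := cantor_perfect.
  by case/(_ A) => [|z [zx _ Az]]; [apply: open_nbhs_nbhs; split=> //; case: cA|exists z].
have [U [cU Uz Uy]] := cantor_zero_dimensional zy.
have [|w [Aw Uw] ws] := IHs (A `&` U) (clopenI cA cU); first by exists z.
exists w => //; rewrite inE negb_or ws andbT.
by apply/eqP => wy; rewrite wy in Uw.
Qed.

Lemma clopen_split A : clopen A -> A !=set0 ->
  exists B, [/\ clopen B, B `<=` A, B !=set0 & A `\` B !=set0].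
Proof.
move=> cA A0; have [x Ax _] := clopen_infinite [::] cA A0.
have [y Ay yx] := clopen_infinite [:: x] cA A0.
have [U [cU Ux Uy]] : exists U, [/\ clopen U, U x & ~ U y].
  by apply: cantor_zero_dimensional; rewrite inE in yx; rewrite eq_sym.
exists (A `&` U); split; [exact: clopenI|by move=> z []|by exists x|].
by exists y; split=> // -[].
Qed.

(** Compactness leaves finitely many neighbourhoods; the set is cut along them one at a time, which
    keeps the pieces disjoint. *)
Lemma clopen_ind (P : set X -> Prop) :
  (forall x, exists Q, [/\ clopen Q, Q x &
     forall B, clopen B -> B `<=` Q -> P B]) ->
  (forall A B, clopen A -> clopen B -> A `&` B = set0 -> P A -> P B -> P (A `|` B)) ->
  forall A, clopen A -> P A.
Proof.
move=> loc PU.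
have /choice[Q HQ] := loc.
have := cantor_space_compact; rewrite compact_cover => /(_ X setT Q).
case=> [x _|x _|s _ cov]; first by have [[]] := HQ x.
  by exists x => //; have [] := HQ x.
have {s cov} [t covt] : exists t : seq X, forall x, exists2 i, i \in t & Q i x.
  by exists (finmap.enum_fset s) => x; have [i si Qi] := cov x I; exists i.
suff cov A : clopen A -> (forall x, A x -> exists2 i, i \in t & Q i x) -> P A.
  by move=> A cA; apply: cov.
elim: t {covt} A => [|i t IHt] A cA At.
  by have [_ _ PQ] := HQ (fun=> false); apply: PQ => // x /At[].
have [cQ _ PQ] := HQ i.
have -> : A = (A `&` Q i) `|` (A `\` Q i).
  apply/predeqP => x; split=> [Ax|[[]|[]]] //.
  by have [|] := pselect (Q i x); [left|right].
apply: PU.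
- exact: clopenI.
- exact: clopenD.
- by apply/predeqP => x; split=> // -[[_ ?] []].
- by apply: PQ => [|x []] //; apply: clopenI.
- apply: IHt; first exact: clopenD.
  move=> x [Ax Qix]; have [j] := At x Ax.
  by rewrite inE => /orP[/eqP ->|jt Qj] //; exists j.
Qed.

End CantorClopen.

(** * Compressing clopen sets by elements and by commutators *)

Section Vigorous.
Variable G : set (homeo X).
Hypothesis sG : subgroup G.
Hypothesis vG : vigorous G.

(* Vigour with the properness of [C] dropped, and with [B] possibly empty. *)
Lemma vigorous_push (A B C : set X) : clopen A -> clopen B -> clopen C ->
  B `<=` A -> A `\` B !=set0 -> C `<=` A -> C !=set0 ->
  exists k, [/\ G k, supported A k & forall x, B x -> C (k x)].
Proof.
move=> cA cB cC BA [z [Az Bz]] CA [c Cc].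
have [B0|/set0P B0] := eqVneq B set0.
  by exists 1; split=> //; [apply: subgroup1|move=> x; rewrite B0].
have [C' [cC' C'C C'0 CC']] := clopen_split cC (ex_intro _ c Cc).
have [||k [Gk kB kA]] := vG cA cB cC' B0 C'0.
- by split=> // /(_ z Az).
- split; first exact: subset_trans CA.
  by move=> AC'; case: CC' => y [Cy]; apply; apply/AC'/CA.
exists k; split=> // x Bx; apply/C'C/kB; by exists x.
Qed.

Definition commutators_in (A : set X) : set (homeo X) :=
  [set h | exists u v, [/\ G u, G v, supported A u, supported A v & h = [~ u, v]]].

Lemma commutators_inS A B : A `<=` B -> commutators_in A `<=` commutators_in B.
Proof.
move=> AB h [u [v [Gu Gv uA vA ->]]]; exists u, v; split=> //; exact: supportedS AB _.
Qed.

Lemma commutators_inJ A k h : G k -> commutators_in A h -> commutators_in (img k A) (h ^ k).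
Proof.
move=> Gk [u [v [Gu Gv uA vA ->]]]; exists (u ^ k), (v ^ k).
by rewrite conjRg; split=> //; try exact: subgroupJ; apply: supportedJ.
Qed.

Lemma commutators_inG A : commutators_in A `<=` G.
Proof. by move=> h [u [v [Gu Gv _ _ ->]]]; apply: subgroupR. Qed.

Lemma commutators_in_supported A h : commutators_in A h -> supported A h.
Proof. by case=> [u [v [_ _ uA vA ->]]]; apply: supportedR. Qed.

(** Take [g] pushing [B] into [C] inside a smaller set [A'], and [k] moving [A'] off itself within
    [A]. Then [[~ g^-1, k]] is [g] followed by a conjugate of [g^-1] supported off [A'], so on [B]
    it acts as [g]. Commutators are needed because absorption only provides commutators. *)
Lemma commutators_in_push (A B C : set X) : clopen A -> clopen B -> clopen C ->
  B `<=` A -> A `\` B !=set0 -> C `<=` A -> C !=set0 ->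
  exists2 d, commutators_in A d & forall x, B x -> C (d x).
Proof.
move=> cA cB cC BA [z [Az Bz]] CA [c Cc].
have [c' Cc' c'z] := clopen_infinite [:: z] cC (ex_intro _ c Cc).
have [N [cN Nc Nz]] : exists N, [/\ clopen N, N c' & ~ N z].
  by apply: cantor_zero_dimensional; rewrite inE in c'z.
pose C0 := C `&` N; have cC0 : clopen C0 by apply: clopenI.
have [||y [Ay BCy] yz] := @clopen_infinite (A `\` (B `|` C0)) [:: z].
- by apply: clopenD => //; apply: clopenU.
- by exists z; split=> // -[|[]].
have [M [cM My Mz]] : exists M, [/\ clopen M, M y & ~ M z].
  by apply: cantor_zero_dimensional; rewrite inE in yz.
(* This is the part of [A] lying in [M], [B] or [C0]. It contains the spare point [y] needed to push
   [B], and misses [z], which leaves room to move it off itself. *)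
pose A' := A `\` ([set x | ~ M x] `\` (B `|` C0)).
have cA' : clopen A'.
  do !apply: clopenD => //; first exact: clopenC.
  exact: clopenU.
have A'z : ~ A' z by case=> _; apply; split=> // -[|[]].
have A'y : A' y by split=> // -[].
have A'A : A' `<=` A by move=> x [].
have BA' : B `<=` A' by move=> x Bx; split=> [|[_]]; [apply: BA|apply; left].
have C0A' : C0 `<=` A' by move=> x Cx; split=> [|[_]]; [apply/CA; case: Cx|apply; right].
have [g [Gg gA' gB]] : exists g, [/\ G g, supported A' g & forall x, B x -> C0 (g x)].
  apply: vigorous_push => //; last by exists c'.
  by exists y; split=> // By; apply: BCy; left.
have [k [Gk kA kA']] : exists k, [/\ G k, supported A k & forall x, A' x -> (A `\` A') (k x)].
  have AA'0 : A `\` A' !=set0 by exists z.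
  by apply: vigorous_push => //; apply: clopenD.
exists [~ g^-1, k].
  exists g^-1, k; split=> //; first exact: subgroupV.
  by apply: supportedV; apply: supportedS gA'.
move=> x Bx; have [Cgx _] := gB x Bx.
rewrite commgEl invgK homeoM.
have -> : (g^-1 ^ k) (g x) = g x; last by [].
apply: (supportedJ (supportedV gA')) => /imgP[y' A'y' e].
by have [_] := kA' y' A'y'; rewrite e; apply; apply/C0A'/gB.
Qed.

End Vigorous.

(** * Approximate fullness *)

Section ApproximateFullness.
Variable G : set (homeo X).
Hypothesis sG : subgroup G.
Hypothesis vG : vigorous G.

(** Conjugate [s] by an element that fixes [P] and its image pointwise and compresses the rest of
    the support of [s] into [J]: the action on [P] is unchanged and all side effects land in [J]. *)
Lemma transplant (s : homeo X) (A P J : set X) : G s -> supported A s ->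
  clopen A -> clopen P -> clopen J -> J !=set0 -> ~` A `\` P !=set0 ->
  (forall x, J x -> ~ P x) -> (forall x, P x -> ~ J (s x)) ->
  exists h, [/\ G h, supported (P `|` img s P `|` J) h & forall x, P x -> h x = s x].
Proof.
move=> Gs sA cA cP cJ J0 [z [Az Pz]] JP PJ.
have cPs : clopen (P `|` img s P) by apply: clopenU => //; apply: clopen_img.
pose D := ~` (P `|` img s P); have cD : clopen D by apply: clopenC.
have Psz : ~ img s P z.
  by move=> /imgP[x Px e]; apply: Pz; rewrite -(homeo_inj (etrans e (esym (sA z Az)))).
have [k [Gk kD kJ]] : exists k, [/\ G k, supported D k & forall x, (A `&` D) x -> J (k x)].
  apply: (vigorous_push sG vG) => //.
  - exact: clopenI.
  - by exists z; split=> [[]|[]].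
  - by move=> x Jx [/(JP _ Jx)//|/imgP[y Py e]]; apply: (PJ y); rewrite ?e.
have Pk x : (P `|` img s P) x -> k x = x by move=> Px; apply: kD.
exists (s ^ k); split=> [||x Px]; first exact: subgroupJ.
- move=> x xW; rewrite homeoJ -[RHS](homeoVK k); congr (k _); apply: sA => Akx.
  have [Dkx|Dkx] := pselect (D (k^-1 x)).
    by apply: xW; right; rewrite -(homeoVK k x); apply: kJ.
  by apply: xW; left; have := contrapT Dkx => Px; rewrite -(homeoVK k x) Pk.
rewrite homeoJ -{1}(Pk x); last by left.
by rewrite homeoK Pk //; right; apply/imgE.
Qed.

(* [g] can be imitated near every point by elements of [G] supported close to
   the piece they imitate and its image. *)
Definition locally_imitable (g : homeo X) := forall x : X, exists Q, [/\ clopen Q, Q x &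
  forall P J : set X, clopen P -> P `<=` Q -> clopen J -> J !=set0 ->
    (forall y, J y -> ~ P y) -> (forall y, P y -> ~ J (g y)) ->
    exists h, [/\ G h, supported (P `|` img g P `|` J) h & forall y, P y -> h y = g y]].

Lemma locally_imitable_supported (A : set X) s : G s -> clopen A -> ~` A !=set0 ->
  supported A s -> locally_imitable s.
Proof.
move=> Gs cA A0 sA x.
have [z Az zx] := clopen_infinite [:: x] (clopenC A cA) A0.
have [Q [cQ Qx Qz]] : exists Q, [/\ clopen Q, Q x & ~ Q z].
  by apply: cantor_zero_dimensional; rewrite inE eq_sym in zx.
exists Q; split=> // P J cP PQ cJ J0 JP PJ.
apply: (transplant Gs sA) => //; by exists z; split=> // /PQ.
Qed.

Lemma locally_imitable1 : locally_imitable 1.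
Proof.
move=> x; exists setT; split=> // [|P J *]; first exact: clopenT.
by exists 1; split=> //; apply: subgroup1.
Qed.

Lemma locally_imitableV g : locally_imitable g -> locally_imitable g^-1.
Proof.
move=> lg x; have [Q [cQ Qx QP]] := lg (g^-1 x).
exists (img g Q); split=> // [|P J cP PQ cJ J0 JP PJ]; first exact: clopen_img.
have [|y Py|||y Jy|y Py|h [Gh hP hg]] := QP (img g^-1 P) J => //.
- exact: clopen_img.
- by have /imgP[z Pz <-] := Py; apply: PQ.
- by move=> /imgP[z Pz e]; apply: (PJ z) => //; rewrite e.
- by have /imgP[z Pz <-] := Py; rewrite homeoVK => /JP.
exists h^-1; split; first exact: subgroupV.
  apply: supportedV; apply: supportedS hP => y; rewrite imgKV.
  by move=> [[]|]; [left; right|left; left|right].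
move=> y Py; apply: (@homeo_inj _ h); rewrite homeoVK hg ?homeoVK //.
by apply/imgP; exists y.
Qed.

(** The product of two imitations has the right action but too large a support: it contains the
    intermediate image [Pg] and the error set [J3]. That support is still proper, as [j2] lies
    outside it, so [transplant] shrinks it; [j1] keeps [J3] nonempty. *)
Lemma locally_imitableM g g' :
  locally_imitable g -> locally_imitable g' -> locally_imitable (g * g').
Proof.
move=> lg lg' x; have [Q [cQ Qx QP]] := lg x; have [Q' [cQ' Q'x Q'P]] := lg' (g x).
pose s := [:: x; g x; g' (g x)].
have [j1 _ sj1] := clopen_infinite s clopenT (ex_intro _ x I).
have [j2 _ sj2] := clopen_infinite (j1 :: s) clopenT (ex_intro _ x I).
have av y : y \in s -> exists N, [/\ clopen N, N y, ~ N j1 & ~ N j2].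
  move=> ys; have [|N [cN Ny Nj]] := @clopen_avoid y [:: j1; j2].
    rewrite !inE negb_or; apply/andP; split; apply/eqP => e.
      by rewrite e (negPf sj1) in ys.
    by move: sj2; rewrite inE -e ys orbT.
  by exists N; split=> //; apply: Nj; rewrite !inE eqxx ?orbT.
have [|N0 [cN0 N0x N01 N02]] := av x; first by rewrite !inE eqxx.
have [|N1 [cN1 N1x N11 N12]] := av (g x); first by rewrite !inE eqxx orbT.
have [|N2 [cN2 N2x N21 N22]] := av (g' (g x)); first by rewrite !inE eqxx !orbT.
have [J' [cJ' J'1 J'2]] : exists J', [/\ clopen J', J' j1 & ~ J' j2].
  by apply: cantor_zero_dimensional; move: sj2; rewrite inE eq_sym negb_or => /andP[].
have cpre (h : homeo X) (A : set X) : clopen A -> clopen [set y | A (h y)].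
  by move=> cA; apply: (clopen_img (h^-1) cA).
exists (Q `&` [set y | Q' (g y)] `&` (N0 `&` [set y | N1 (g y)] `&` [set y | N2 (g' (g y))])).
split; [by do !apply: clopenI => //; [apply: cpre..|apply: (cpre (g * g'))]|by []|].
move=> P J cP PQ cJ J0 JP PJ.
pose Pg := img g P; pose Pgg := img g' Pg.
have cPg : clopen Pg by apply: clopen_img.
have cPgg : clopen Pgg by apply: clopen_img.
pose J3 := J' `\` (P `|` Pg `|` Pgg).
have cJ3 : clopen J3 by apply: clopenD => //; do !apply: clopenU.
have PN y : P y -> N0 y by case/PQ => _ [[]].
have PgN y : Pg y -> N1 y by case/imgP => u /PQ[_ [[_ ?] _]] <-.
have PggN y : Pgg y -> N2 y by case/imgP => v /imgP[u /PQ[_ [_ ?]] <-] <-.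
have J30 : J3 !=set0 by exists j1; split=> // -[[/PN|/PgN]|/PggN].
have [||||y [_ nPy] Py|y Py [_ nPy]|h1 [Gh1 h1P h1g]] := QP P J3 => //.
- by move=> y /PQ[[]].
- by apply: nPy; left; left.
- by apply: nPy; left; right; apply/imgE.
have [||||y [_ nPy] Py|y Py [_ nPy]|h2 [Gh2 h2P h2g]] := Q'P Pg J3 => //.
- by move=> y /imgP[u /PQ[[_ ?] _] <-].
- by apply: nPy; left; right.
- by apply: nPy; right; apply/imgE.
have hg y : P y -> (h1 * h2) y = (g * g') y.
  by move=> Py; rewrite !homeoM h1g // h2g //; apply/imgE.
have [|||||||||h [Gh hP hE]] := @transplant (h1 * h2) (P `|` Pg `|` Pgg `|` J3) P J => //.
- exact: subgroupM.
- apply: supportedM.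
    by apply: supportedS h1P => y [[]|]; [left; left; left|left; left; right|right].
  by apply: supportedS h2P => y [[]|]; [left; left; right|left; right|right].
- by do !apply: clopenU.
- exists j2; split=> [|/PN //].
  by move=> [[[/PN|/PgN]|/PggN]|[]].
- by move=> y Py; rewrite hg //; apply: PJ.
exists h; split=> // [|y Py]; last by rewrite hE // hg.
apply: supportedS hP => y [[Py|/imgP[u Pu <-]]|Jy]; [by left; left| |by right].
by left; right; rewrite hg //; apply/imgE.
Qed.

Hypothesis simG : simple_group G.

Lemma vigorous_nontrivial : exists A s : _, [/\ clopen A, ~` A !=set0, G s, supported A s & s <> 1].
Proof.
pose x0 : X := fun=> false.
have [A [cA _ A0 [z [_ Az]]]] := clopen_split clopenT (ex_intro _ x0 I).
have [B [cB BA B0 AB0]] := clopen_split cA A0.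
have [|k [Gk kA kB]] := vigorous_push sG vG cA cB (clopenD cA cB) BA AB0 _ AB0.
  by move=> x [].
exists A, k; split=> //; first by exists z.
by move=> k1; have [b Bb] := B0; have [_] := kB b Bb; rewrite k1.
Qed.

(** Elements fixing some nonempty clopen set pointwise are imitable by [transplant]; they form a
    conjugation-invariant family, so simplicity reaches all of [G]. *)
Lemma all_locally_imitable g : G g -> locally_imitable g.
Proof.
pose S := [set s | G s /\ exists A, [/\ clopen A, ~` A !=set0 & supported A s]].
pose K := [set s | G s /\ locally_imitable s].
suff GK : G `<=` K by move=> /GK[].
apply: (@simple_sub_conj_closed _ G S K sG simG).
- by move=> s [].
- move=> s k [Gs [A [cA [z Az] sA]]] Gk; split; first exact: subgroupJ.
  exists (img k A); split; [exact: clopen_img| |exact: supportedJ].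
  by exists (k z) => /imgE.
- have [A [s [cA A0 Gs sA s1]]] := vigorous_nontrivial.
  by exists s => //; split=> //; exists A.
- apply: subgroup_intro.
  + by split; [apply: subgroup1|apply: locally_imitable1].
  + by move=> s t [Gs ls] [Gt lt]; split; [apply: subgroupM|apply: locally_imitableM].
  + by move=> s [Gs ls]; split; [apply: subgroupV|apply: locally_imitableV].
- move=> s [Gs [A [cA A0 sA]]]; split=> //.
  exact: locally_imitable_supported Gs cA A0 sA.
Qed.

End ApproximateFullness.

(** * Gluing maps that are locally in the group *)

Section Gluing.
Variable G : set (homeo X).
Hypothesis sG : subgroup G.
Hypothesis vG : vigorous G.
Hypothesis simG : simple_group G.

Definition locally_in (P : set X) (theta : X -> X) := forall x, P x ->
  exists Q g, [/\ clopen Q, Q x, G g & forall y, Q y -> P y -> theta y = g y].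

(** Induction over clopen pieces of [P]. As [theta] is injective and moves [P] off itself, the
    imitation of one piece disturbs neither another piece nor its image, so the imitations can
    simply be multiplied. *)
Lemma glue_disjoint (P J : set X) theta : clopen P -> locally_in P theta ->
  {in P &, injective theta} -> (forall x, P x -> ~ P (theta x)) ->
  clopen J -> J !=set0 -> (forall y, J y -> ~ P y) -> (forall y, P y -> ~ J (theta y)) ->
  exists h, [/\ G h, supported (P `|` theta @` P `|` J) h & forall y, P y -> h y = theta y].
Proof.
move=> cP locP injP Ptheta.
have {}injP x y : P x -> P y -> theta x = theta y -> x = y.
  by move=> Px Py; apply: injP; apply/mem_set.
pose PhiJ B J := exists h, [/\ G h, supported ((B `&` P) `|` theta @` (B `&` P) `|` J) h &
  forall y, B y -> P y -> h y = theta y].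
pose Phi B := forall J, clopen J -> J !=set0 -> (forall y, J y -> ~ P y) ->
  (forall y, P y -> ~ J (theta y)) -> PhiJ B J.
move=> cJ J0 JP PJ; suff : Phi setT.
  case/(_ J cJ J0 JP PJ) => h [Gh hP hE]; exists h; split=> // [|y Py]; last exact: hE.
  by move: hP; rewrite setTI.
clear J cJ J0 JP PJ.
apply: (@clopen_ind Phi _ _ setT clopenT) => [x|A B cA cB AB PA PB].
  have [Px|Px] := pselect (P x); last first.
    exists (~` P); split=> // [|B cB BP J cJ J0 JP PJ]; first exact: clopenC.
    exists 1; split=> [||y /BP//]; first exact: subgroup1.
    by [].
  have [Q [g [cQ Qx Gg gE]]] := locP x Px.
  have [Q' [cQ' Q'x Q'P]] := all_locally_imitable sG vG simG Gg x.
  exists (Q `&` Q'); split=> //; first exact: clopenI.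
  move=> B cB BQ J cJ J0 JP PJ.
  have gE' y : B y -> P y -> theta y = g y by move=> /BQ[Qy _]; apply: gE.
  have [|||||y [By Py]|h [Gh hP hE]] := Q'P (B `&` P) J => //.
  - exact: clopenI.
  - by move=> y [/BQ[]].
  - by move=> y /JP Py [].
  - by rewrite -gE' //; apply: PJ.
  exists h; split=> // [|y By Py]; last by rewrite gE' // hE.
  apply: supportedS hP => y [[Py|/imgP[z [Bz Pz] <-]]|Jy]; [by left; left| |by right].
  by left; right; exists z => //; apply: gE'.
move=> J cJ J0 JP PJ; have [J1 [cJ1 J1J J10 JJ1]] := clopen_split cJ J0.
have [||h1 [Gh1 h1P h1E]] := PA J1 cJ1 J10.
- by move=> y /J1J/JP.
- by move=> y /PJ Jy /J1J.
have [|||h2 [Gh2 h2P h2E]] := PB (J `\` J1) _ JJ1.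
- exact: clopenD.
- by move=> y [/JP].
- by move=> y /PJ Jy [].
have ABF x : A x -> B x -> False by apply: disjoint_mem AB.
exists (h1 * h2); split; first exact: subgroupM.
  apply: supportedM.
    apply: supportedS h1P => y [[[Ay Py]|[z [Az Pz] <-]]|/J1J Jy]; [|left; right|by right].
      by left; left; split=> //; left.
    by exists z => //; split=> //; left.
  apply: supportedS h2P => y [[[Ay Py]|[z [Az Pz] <-]]|[Jy _]]; [|left; right|by right].
    by left; left; split=> //; right.
  by exists z => //; split=> //; right.
have Jtheta y : P y -> J (theta y) -> False by move=> /PJ.
move=> y [Ay|By] Py; rewrite homeoM.
  rewrite h1E // h2P // => -[[[_ Pt]|[z [Bz Pz] e]]|[Jt _]].
  - exact: Ptheta Py Pt.
  - by apply: (ABF y) => //; rewrite -(injP _ _ Pz Py e).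
  - exact: Jtheta Py Jt.
rewrite h1P ?h2E // => -[[[Ay _]|[z [Az Pz] e]]|/J1J/JP Jy].
- exact: ABF Ay By.
- by apply: (Ptheta z) => //; rewrite e.
- exact: Jy.
Qed.

(** Reduction to [glue_disjoint]: first park [P] inside [J1], then apply [theta] from the parked
    copy. The images avoid [J], hence the parked copy is moved off itself. *)
Lemma glue (P J : set X) theta : clopen P -> locally_in P theta ->
  {in P &, injective theta} ->
  clopen J -> J !=set0 -> (forall y, J y -> ~ P y) -> (forall y, P y -> ~ J (theta y)) ->
  exists h, [/\ G h, supported (P `|` theta @` P `|` J) h & forall y, P y -> h y = theta y].
Proof.
move=> cP locP injP cJ J0 JP PJ.
have [J1 [cJ1 J1J J10 JJ1]] := clopen_split cJ J0.
have [|||||||k [Gk kP kJ]] := @vigorous_push G sG vG (P `|` J1) P J1 => //.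
- exact: clopenU.
- by have [j Jj] := J10; exists j; split; [right|apply/JP/J1J].
have [||||||||h [Gh hP hE]] := @glue_disjoint (img k P) (J `\` J1) (fun x => theta ((k^-1)%g x)) => //.
- exact: clopen_img.
- move=> x Px; have [Q [g [cQ Qx Gg gE]]] := locP _ Px.
  exists (img k Q), (k^-1 * g); split=> //; first exact: clopen_img.
    by apply: subgroupM => //; apply: subgroupV.
  by move=> y Qy Py /=; rewrite gE.
- move=> x y /set_mem Px /set_mem Py /= e; apply: (@homeo_inj _ (k^-1)).
  by apply: injP e; apply/mem_set.
- move=> x Px /imgP[z /kJ Jz e]; apply: (PJ _ Px); rewrite /= in e.
  by rewrite -e; apply: J1J.
- exact: clopenD.
- by move=> y [_ Jy] /imgP[z /kJ Jz e]; apply: Jy; rewrite -e.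
- by move=> y /PJ Py [].
exists (k * h); split; first exact: subgroupM.
  apply: supportedM.
    by apply: supportedS kP => x [|/J1J]; [left; left|right].
  apply: supportedS hP => x [[/imgP[z /kJ/J1J Jz <-]|[z Pz <-]]|[Jx _]]; try by right.
  by left; right; exists (k^-1 z).
move=> y Py; rewrite homeoM hE; last exact/imgE.
by rewrite homeoK.
Qed.

Definition tile (T : set X) (e : nat -> homeo X) i := img (e i) T.

Definition tiles (T : set X) (e : nat -> homeo X) n : set X :=
  [set x | exists2 i, (i < n)%N & tile T e i x].

Definition disjoint_tiles T e n := forall i j x, (i < n)%N -> (j < n)%N ->
  tile T e i x -> tile T e j x -> i = j.

Lemma clopen_tiles T e n : clopen T -> clopen (tiles T e n).
Proof.
move=> cT; elim: n => [|n IHn].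
  suff -> : tiles T e 0 = set0 by apply: clopen0.
  by apply/predeqP => x; split=> // -[].
suff -> : tiles T e n.+1 = tiles T e n `|` tile T e n.
  by apply: clopenU => //; apply: clopen_img.
apply/predeqP => x; split=> [[i]|[[i ni Ti]|Tn]].
- by rewrite ltnS leq_eqVlt => /orP[/eqP ->|ni Ti]; [right|left; exists i].
- by exists i => //; apply: ltnW.
- by exists n.
Qed.

Lemma transport_tiles T e e' n J : clopen T ->
  (forall i, (i < n)%N -> G (e i)) -> (forall i, (i < n)%N -> G (e' i)) ->
  disjoint_tiles T e n -> disjoint_tiles T e' n ->
  clopen J -> J !=set0 -> J `&` tiles T e n = set0 -> J `&` tiles T e' n = set0 ->
  exists h, [/\ G h, supported (tiles T e n `|` tiles T e' n `|` J) h &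
    forall i x, (i < n)%N -> T x -> h (e i x) = e' i x].
Proof.
move=> cT Ge Ge' de de' cJ J0 JT JT'.
(* Off the tiles [find] returns [n], a junk index; [theta] is only evaluated on the tiles. *)
pose idx x := find (fun i => `[< tile T e i x >]) (iota 0 n).
pose theta x := e' (idx x) ((e (idx x))^-1 x).
have idxE i x : (i < n)%N -> tile T e i x -> idx x = i.
  move=> ni Tix; have hx : has (fun i => `[< tile T e i x >]) (iota 0 n).
    by apply/hasP; exists i; rewrite ?mem_iota //; apply/asboolP.
  have nx : (idx x < n)%N by rewrite -[n in (_ < n)%N](size_iota 0) -has_find.
  apply: (de _ _ x) => //; apply/asboolP; have := nth_find 0%N hx.
  by rewrite nth_iota.
have thetaE i x : (i < n)%N -> T x -> theta (e i x) = e' i x.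
  move=> ni Tx; rewrite /theta (idxE i) ?homeoK //; exact/imgE.
have [|||||h [Gh hP hE]] := @glue (tiles T e n) J theta _ _ _ cJ J0.
- exact: clopen_tiles.
- move=> x [i ni Tix]; exists (tile T e i), ((e i)^-1 * e' i); split=> //.
  + exact: clopen_img.
  + by apply: subgroupM => //; [apply: subgroupV|]; auto.
  + by move=> y Tiy _; rewrite /theta (idxE i).
- move=> x y /set_mem[i ni /imgP[u Tu <-]] /set_mem[j nj /imgP[v Tv <-]].
  rewrite !thetaE // => e0; have ij : i = j.
    by apply: (de' _ _ (e' i u)) => //; [|rewrite e0]; apply/imgE.
  by move: e0; rewrite -ij => /homeo_inj ->.
- by move=> y; apply: disjoint_mem.
- move=> y [i ni /imgP[u Tu <-]]; rewrite thetaE // => /(disjoint_mem JT'); apply.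
  by exists i => //; apply/imgE.
exists h; split=> // [|i x ni Tx]; last first.
  by rewrite hE ?thetaE //; exists i => //; apply/imgE.
apply: supportedS hP => y [[Ty|[z [i ni /imgP[u Tu <-]] <-]]|Jy]; [by left; left| |by right].
by left; right; exists i => //; rewrite thetaE //; apply/imgE.
Qed.

End Gluing.

(** * Exact permutations of tiles *)

(** The permutation is a function on all of [nat], so that it can be given as a list through [nth]
    and checked by computation; only its values below [n] count. *)
Definition permutes_tiles (T : set X) (e : nat -> homeo X) n (w : nat -> nat) (h : homeo X) :=
  (forall i x, (i < n)%N -> T x -> h (e i x) = e (w i) x) /\ supported (tiles T e n) h.

Definition inverse_on n (w w' : nat -> nat) := forall i, (i < n)%N ->
  [/\ (w i < n)%N, (w' i < n)%N, w (w' i) = i & w' (w i) = i].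

Section Construction.
Variable G : set (homeo X).
Hypothesis sG : subgroup G.
Hypothesis vG : vigorous G.
Hypothesis simG : simple_group G.

(** If [s] maps [B] into a proper part [C] of itself, then [B] minus [C] is a wandering set: every
    later translate of it lies inside the translate of [C]. *)
Lemma exists_shift (q : set X) : clopen q -> q !=set0 ->
  exists s (Z : set X), [/\ G s, supported q s & forall k l x, img (s ^+ k) Z x -> img (s ^+ l) Z x -> k = l] /\
    [/\ clopen Z, Z !=set0 & Z `<=` q].
Proof.
move=> cq q0; have [B [cB Bq B0 qB]] := clopen_split cq q0.
have [C [cC CB C0 BC]] := clopen_split cB B0.
have [|s [Gs sq sB]] := vigorous_push sG vG cq cB cC Bq qB _ C0.
  exact: subset_trans Bq.
exists s, (B `\` C); split; last first.
  by split=> //; [exact: clopenD|move=> x [/Bq]].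
split=> //.
suff lt k l x : (k < l)%N -> img (s ^+ k) (B `\` C) x -> img (s ^+ l) (B `\` C) x -> False.
  move=> k l x Zk Zl; have [kl|lk|//] := ltngtP k l.
    by case: (lt _ _ _ kl Zk Zl).
  by case: (lt _ _ _ lk Zl Zk).
move=> kl /imgP[z [Bz Cz] <-] /imgP[z' [Bz' Cz'] e]; apply: Cz.
have -> : z = s ((s ^+ (l - k).-1) z').
  apply: (@homeo_inj _ (s ^+ k)); rewrite -e.
  suff -> : s ^+ l = s ^+ (l - k).-1 * s * s ^+ k by [].
  by rewrite -expgSr prednK ?subn_gt0 // -expgnDr subnK // ltnW.
apply: (sB); elim: (l - k).-1 => [|m IHm] //.
by rewrite expgSr homeoM; apply/CB/sB.
Qed.

(** The translates of a wandering set are infinitely many disjoint targets; a proper [T] is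
    compressed into each of the first [n], and the next one stays free as [M]. *)
Lemma exists_tiles (T : set X) n : clopen T -> ~` T !=set0 ->
  exists e (M : set X), [/\ forall i, G (e i), disjoint_tiles T e n, clopen M, M !=set0 &
    M `&` tiles T e n = set0].
Proof.
move=> cT T0; have [x0 _] := T0.
have [s [Z [[Gs _ sZ] [cZ Z0 _]]]] := exists_shift clopenT (ex_intro _ x0 I).
have cA k : clopen (img (s ^+ k) Z) by apply: clopen_img.
have A0 k : img (s ^+ k) Z !=set0.
  by have [z Zz] := Z0; exists ((s ^+ k) z); apply/imgE.
have /choice[e eP] : forall k, exists e, G e /\ forall x, T x -> img (s ^+ k) Z (e x).
  move=> k; have [|||h [Gh _ hT]] := vigorous_push sG vG clopenT cT (cA k) _ _ _ (A0 k) => //.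
    by have [z Tz] := T0; exists z.
  by exists h.
have tA i x : tile T e i x -> img (s ^+ i) Z x.
  by move=> /imgP[y Ty <-]; apply: (eP i).2.
exists e, (img (s ^+ n) Z); split=> //.
- by move=> i; apply: (eP i).1.
- by move=> i j x _ _ /tA Ai /tA Aj; apply: sZ Ai Aj.
- apply/predeqP => x; split=> // -[An [i ni /tA Ai]].
  by rewrite (sZ _ _ _ An Ai) ltnn in ni.
Qed.

(* A permutation of tiles is only realised up to some error outside the tiles,
   but two such errors can be given disjoint supports, so that commutators of
   permutations are realised exactly. *)
Lemma permutes_tiles_commutator T e n w w' u u' M : clopen T ->
  (forall i, (i < n)%N -> G (e i)) -> disjoint_tiles T e n ->
  clopen M -> M !=set0 -> M `&` tiles T e n = set0 ->
  inverse_on n w w' -> inverse_on n u u' ->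
  exists2 h, G h & permutes_tiles T e n (fun i => u (w (u' (w' i)))) h.
Proof.
move=> cT Ge de cM M0 MT ww' uu'.
have [J1 [cJ1 J1M J10 MJ1]] := clopen_split cM M0.
have perm v v' J : inverse_on n v v' -> clopen J -> J !=set0 -> J `<=` M ->
  exists h, [/\ G h, supported (tiles T e n `|` J) h,
    forall i x, (i < n)%N -> T x -> h (e i x) = e (v i) x &
    forall i x, (i < n)%N -> T x -> h^-1 (e i x) = e (v' i) x].
  move=> vv' cJ J0 JM.
  have tv x : tiles T (e \o v) n x -> tiles T e n x.
    by move=> [i ni Ti]; exists (v i) => //; have [] := vv' i ni.
  have JT : J `&` tiles T e n = set0.
    by apply/predeqP => x; split=> // -[/JM Mx Tx]; rewrite -MT.
  have [|||||||||h [Gh hP hE]] := @transport_tiles G sG vG simG T e (e \o v) n J => //.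
  - by move=> i ni; apply: Ge; have [] := vv' i ni.
  - move=> i j x ni nj Ti Tj; have [vi _ _ <-] := vv' i ni; have [vj _ _ <-] := vv' j nj.
    by congr v'; apply: de Ti Tj.
  - by apply/predeqP => x; split=> // -[Jx /tv Tx]; rewrite -JT.
  exists h; split=> //.
    by apply: supportedS hP => x [[|/tv]|]; [left|left|right].
  move=> i x ni Tx; apply: (@homeo_inj _ h); rewrite homeoVK hE //=.
    by have [_ _ ->] := vv' i ni.
  by have [] := vv' i ni.
have [a [Ga aP aE aV]] := perm w w' J1 ww' cJ1 J10 J1M.
have [|b [Gb bP bE bV]] := perm u u' (M `\` J1) uu' (clopenD cM cJ1) MJ1.
  by move=> x [].
exists [~ a, b]; first exact: subgroupR.
split=> [i x ni Tx|].
  have [_ w'i _ _] := ww' i ni; have [_ u'i _ _] := uu' _ w'i.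
  have [wi _ _ _] := ww' _ u'i.
  by rewrite homeoR aV // bV // aE // bE.
have inv (h : homeo X) v v' : inverse_on n v v' -> (forall i x, (i < n)%N -> T x -> h (e i x) = e (v i) x) ->
    (forall i x, (i < n)%N -> T x -> h^-1 (e i x) = e (v' i) x) ->
    forall x, tiles T e n (h x) <-> tiles T e n x.
  move=> vv' hE hV x; split=> -[i ni /imgP[y Ty ey]]; have [vi v'i _ _] := vv' i ni.
    by exists (v' i) => //; apply/imgP; exists y; rewrite // -hV // ey homeoK.
  by exists (v i) => //; apply/imgP; exists y; rewrite // -hE // ey.
apply: (commutator_supported _ _ aP bP); [exact: inv aE aV|exact: inv bE bV|].
by move=> x [[//|J1x] [//|[]]].
Qed.

Lemma exists_three_cycle : exists (T q : set X) (c : homeo X),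
  [/\ clopen T, ~` T !=set0, G c, supported T c & c ^+ 3 = 1] /\
  [/\ clopen q, q !=set0, q `<=` T & forall x, q x -> ~ q (c x) /\ ~ q (c (c x))].
Proof.
pose x0 : X := fun=> false.
have [Y [cY _ Y0 [z [_ Yz]]]] := clopen_split clopenT (ex_intro _ x0 I).
have [e [M [Ge de cM M0 MT]]] := @exists_tiles Y 3 cY (ex_intro _ z Yz).
(* In the symmetric group on three letters a transposition inverts the 3-cycle [w], so their
   commutator is the inverse square of [w], which is [w] again. *)
have [|||c Gc [cE cT]] := @permutes_tiles_commutator Y e 3 (nth 0 [:: 1; 2; 0])%N
  (nth 0 [:: 2; 0; 1])%N (nth 0 [:: 0; 2; 1])%N (nth 0 [:: 0; 2; 1])%N M cY _ de cM M0 MT => //.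
- by case=> [|[|[|]]].
- by case=> [|[|[|]]].
have c0 x : Y x -> c (e 0%N x) = e 1%N x by apply: cE.
have c1 x : Y x -> c (e 1%N x) = e 2%N x by apply: cE.
have c2 x : Y x -> c (e 2%N x) = e 0%N x by apply: cE.
exists (tiles Y e 3), (img (e 0%N) Y), c; split; split=> //.
- exact: clopen_tiles.
- have [m Mm] := M0; exists m => Tm; apply: disjoint_mem MT Mm Tm.
- apply: homeo_ext => x; rewrite !expgS expg0 mulg1 !homeoM homeo1E.
  have [[i i3 /imgP[y Yy <-]]|Tx] := pselect (tiles Y e 3 x); last by rewrite !cT.
  by case: i i3 => [|[|[|]]] // _; do 3!rewrite ?(c0, c1, c2) //.
- exact: clopen_img.
- by have [y Yy] := Y0; exists (e 0%N y); apply/imgE.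
- by move=> x Yx; exists 0%N.
- move=> x /imgP[y Yy <-]; rewrite c0 // c1 //.
  by split=> Y0y; [have := de 1%N 0%N _ isT isT _ Y0y|have := de 2%N 0%N _ isT isT _ Y0y];
    move/(_ ((imgE _ _ _).2 Yy)).
Qed.

End Construction.

(** * Generation by commutators of small support *)

Section Absorption.
Variables G K : set (homeo X).
Hypothesis sG : subgroup G.
Hypothesis vG : vigorous G.
Hypothesis simG : simple_group G.
Hypothesis sK : subgroup K.
Hypothesis KG : K `<=` G.

(** Only proper clopen parts of [Y] are asked for: the room left over is what makes the pushing
    arguments for unions possible. *)
Definition absorbs (Y : set X) := forall E, clopen E -> E `<=` Y -> Y `\` E !=set0 ->
  commutators_in G E `<=` K.

Lemma absorbs_commutators Y : commutators_in G Y `<=` K -> absorbs Y.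
Proof. by move=> YK E cE EY _; apply: subset_trans YK; apply: commutators_inS. Qed.

Lemma commutators_in_img k E : K k -> commutators_in G (img k E) `<=` K ->
  commutators_in G E `<=` K.
Proof.
move=> Kk EK h hE; have := commutators_inJ sG (KG Kk) hE; move/EK => Khk.
by rewrite -[h](conjgK k); apply: subgroupJ => //; apply: subgroupV.
Qed.

Lemma absorbs_img k Y : K k -> absorbs Y -> absorbs (img k Y).
Proof.
move=> Kk KY E cE EY [z [/imgP[y Yy <-] Ez]].
apply: (@commutators_in_img k^-1); first exact: subgroupV.
apply: KY; first exact: clopen_img.
  move=> x Ex; apply/(imgE k); apply: EY.
  by move: Ex => /imgP[u Eu <-]; rewrite homeoVK.
by exists y; split=> // /imgP[u Eu e]; apply: Ez; rewrite -e homeoVK.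
Qed.

(** If part of the overlap is free, a commutator inside [Y2] pushes what sticks out of [Y1] into
    that free part, and the whole set then lies properly in [Y1]. If [E] fills the overlap, a
    commutator inside [Y1] first carries a free piece of [Y1] into the overlap. Both commutators
    belong to [K] because their supports are proper. *)
Lemma absorbs_left Y1 Y2 E : clopen Y1 -> clopen Y2 -> clopen E ->
  Y1 `&` Y2 !=set0 -> absorbs Y1 -> absorbs Y2 ->
  E `<=` Y1 `|` Y2 -> Y1 `\` E !=set0 -> commutators_in G E `<=` K.
Proof.
move=> cY1 cY2 + [y12 Y12] aY1 aY2.
have cI : clopen (Y1 `&` Y2) by apply: clopenI.
suff main F : clopen F -> F `<=` Y1 `|` Y2 -> Y1 `&` Y2 `\` F !=set0 ->
    commutators_in G F `<=` K.
  move=> cE EY [y [Y1y Ey]]; have [IE|] := pselect (Y1 `&` Y2 `<=` E); last first.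
    move=> nIE; apply: main => //; apply: contrapT => /set0P/negP/negPn/eqP e.
    by apply: nIE; rewrite -setD_eq0.
  have [|B [cB BY B0 [z [Yz Bz]]]] := clopen_split (clopenD cY1 cE) _; first by exists y.
  have sub : B `|` (Y1 `&` Y2) `<=` Y1 by move=> x [/BY[]|[]].
  have [|||||||d dK dB] := @commutators_in_push G sG vG (B `|` (Y1 `&` Y2)) B (Y1 `&` Y2) => //.
  - exact: clopenU.
  - by exists y12; split=> [|/BY[_]]; [right|apply; apply: IE].
  - by exists y12.
  have Kd : K d.
    apply: (aY1 _ _ sub _ _ dK); first exact: clopenU.
    by exists z; split; [case: Yz|case=> [//|Iz]; apply: Yz.2; apply: IE].
  have dY : supported (Y1 `|` Y2) d.
    by apply: supportedS (commutators_in_supported dK) => x /sub; left.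
  apply: (commutators_in_img Kd); apply: main.
  - exact: clopen_img.
  - move=> x /imgP[u Eu <-]; apply/(supported_mem _ dY); exact: EY.
  - have [b Bb] := B0; exists (d b); split; first exact: dB.
    by move=> /imgE Eb; have [_] := BY _ Bb.
move=> cF FY F0; have cM : clopen (Y1 `&` Y2 `\` F) by apply: clopenD.
have [M1 [cM1 M1M M10 [m [Mm M1m]]]] := clopen_split cM F0.
have [F1|/set0P F10] := eqVneq (F `\` Y1) set0.
  have FY1 : F `<=` Y1 by rewrite -setD_eq0.
  by apply: aY1 => //; have [w [[? _] ?]] := F0; exists w.
pose E2 := (F `\` Y1) `|` M1; have cE2 : clopen E2 by apply: clopenU => //; apply: clopenD.
have [|||||||d dK dB] := @commutators_in_push G sG vG E2 (F `\` Y1) M1 => //.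
- exact: clopenD.
- by move=> x Fx; left.
- by have [w M1w] := M10; exists w; split; [right|case=> _; apply; case: (M1M _ M1w) => -[]].
- by move=> x M1x; right.
have Kd : K d.
  apply: (aY2 E2 _ _ _ _ dK) => //.
    move=> x [[Fx nY1]|/M1M[[]]//]; by case: (FY _ Fx).
  by exists m; split; [case: Mm => -[]|case=> [[Fm _]|//]; case: Mm].
apply: (commutators_in_img Kd); apply: aY1; first exact: clopen_img.
  move=> x /imgP[u Fu <-]; have [Y1u|Y1u] := pselect (Y1 u); last first.
    by have /M1M[[]] := dB u (conj Fu Y1u).
  rewrite (commutators_in_supported dK) // => -[[_]//|/M1M[_]]; exact.
exists m; split; first by case: Mm => -[].
move=> /imgP[u Fu e]; have [Y1u|Y1u] := pselect (Y1 u); last first.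
  by apply: M1m; rewrite -e; apply: dB.
move: e; rewrite (commutators_in_supported dK); last by move=> [[_]//|/M1M[_]]; exact.
by move=> e; case: Mm; rewrite -e.
Qed.

Lemma absorbsU Y1 Y2 : clopen Y1 -> clopen Y2 -> Y1 `&` Y2 !=set0 ->
  absorbs Y1 -> absorbs Y2 -> absorbs (Y1 `|` Y2).
Proof.
move=> cY1 cY2 I0 aY1 aY2 E cE EY [z [[Y1z|Y2z] Ez]].
  by apply: (absorbs_left cY1 cY2) => //; exists z.
by apply: (absorbs_left cY2 cY1) => //; rewrite 1?setIC 1?setUC //; exists z.
Qed.

Lemma absorbs_setT : absorbs setT -> G `<=` K.
Proof.
move=> aT.
pose S := [set h | exists E : set X, [/\ clopen E, ~` E !=set0 & commutators_in G E h]].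
apply: (@simple_sub_conj_closed _ G S K sG simG) => //.
- by move=> h [E [_ _ hE]]; apply: commutators_inG hE.
- move=> h k [E [cE [z Ez] hE]] Gk; exists (img k E); split; first exact: clopen_img.
    by exists (k z) => /imgE.
  exact: commutators_inJ.
- pose x0 : X := fun=> false.
  have [A [cA _ A0 [z [_ Az]]]] := clopen_split clopenT (ex_intro _ x0 I).
  have [B [cB BA B0 AB0]] := clopen_split cA A0.
  have [|h hA hB] := commutators_in_push sG vG cA cB (clopenD cA cB) BA AB0 _ AB0.
    by move=> x [].
  exists h; first by exists A; split=> //; exists z.
  by move=> h1; have [b Bb] := B0; have [_] := hB b Bb; rewrite h1.
- move=> h [E [cE [z Ez] hE]]; apply: (aT E) hE => //.
  by exists z.
Qed.

End Absorption.

(** * Local actions *)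

Section LocalActions.
Variable T : topologicalType.
Implicit Types (f g h : homeo T) (A B W : set T).

Lemma agree_on_off W B f : supported B f -> B `&` W = set0 -> agree_on W f 1.
Proof.
move=> fB BW; have fW x : W x -> f x = x.
  by move=> Wx; apply: fB => Bx; apply: disjoint_mem BW Bx Wx.
move=> x; split; last exact: fW.
split=> Wx; last by rewrite fW.
by rewrite -(homeo_inj (fW _ Wx)).
Qed.

Lemma agree_on_img W f g h : agree_on W f g -> agree_on (img h W) (f ^ h) (g ^ h).
Proof.
move=> fg x; rewrite !homeoJ; have [Wf fgE] := fg (h^-1 x).
by split=> [|Wx]; [rewrite imgE Wf|rewrite fgE].
Qed.

Definition preserves W f := forall x, W (f x) <-> W x.

Lemma agree_on_preserves W f g : agree_on W f g -> preserves W f.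
Proof. by move=> fg x; have [] := fg x. Qed.

Lemma preserves_supported W f : supported W f -> preserves W f.
Proof. by move=> fW x; apply: supported_mem. Qed.

Lemma preserves_off W B f : supported B f -> B `&` W = set0 -> preserves W f.
Proof. by move=> fB BW; apply: agree_on_preserves (agree_on_off fB BW). Qed.

Lemma preservesM W f g : preserves W f -> preserves W g -> preserves W (f * g).
Proof. by move=> fW gW x; rewrite homeoM gW fW. Qed.

Lemma preservesX W f n : preserves W f -> preserves W (f ^+ n).
Proof. by move=> fW; elim: n => [|n IHn]; rewrite ?expg0 ?expgS //; apply: preservesM. Qed.

Lemma preservesU A B f : preserves A f -> preserves B f -> preserves (A `|` B) f.
Proof. by move=> fA fB x; split=> -[/fA|/fB]; by [left|right]. Qed.

Lemma preserves_img W f : preserves W f -> img f W = W.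
Proof.
move=> fW; apply/predeqP => x; rewrite -{2}(homeoVK f x) fW.
by split.
Qed.

Lemma img_fix W f : (forall x, W x -> f x = x) -> img f W = W.
Proof.
move=> fW; apply/predeqP => x; split=> [/imgP[y Wy <-]|Wx]; first by rewrite fW.
by apply/imgP; exists x => //; apply: fW.
Qed.

Lemma imgJ f g A : img (f ^ g) (img g A) = img g (img f A).
Proof. by rewrite -!imgM conjgE mulVKg. Qed.

Lemma imgS f A B : A `<=` B -> img f A `<=` img f B.
Proof. by move=> AB x; apply: AB. Qed.

End LocalActions.

(** Sums of two powers of 3 determine the summands. Distinct powers differ by a factor of at least
    3, so a strictly largest term on one side would exceed the whole other side; this makes every
    case linear. *)
Lemma pow3_sidon i j k l : i != j -> (3 ^ k + 3 ^ j = 3 ^ l + 3 ^ i)%N -> k = i.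
Proof.
move=> ij e; have lt3 a b : (a < b)%N -> (3 * 3 ^ a <= 3 ^ b)%N.
  by move=> ab; rewrite -expnS leq_pexp2l.
have p a : (0 < 3 ^ a)%N by rewrite expn_gt0.
have c a b : [\/ a = b /\ 3 ^ a = 3 ^ b, 3 * 3 ^ a <= 3 ^ b | 3 * 3 ^ b <= 3 ^ a]%N.
  by have [/lt3|/lt3|->] := ltngtP a b; [apply: Or32|apply: Or33|apply: Or31].
move: (p i) (p j) (p k) (p l) ij e.
by case: (c k i) => [[]||]; case: (c i j) => [[]||]; case: (c j l) => [[]||];
  case: (c k l) => [[]||]; lia.
Qed.

(** Here [f] carries the [k]-th element of [U] on the translate of [Z] by [3 ^ k] steps. After the
    two further shifts, carriers of the [k]-th and [l]-th elements overlap only if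
    [3 ^ k + 3 ^ j = 3 ^ l + 3 ^ i]. By the Sidon property this singles out one translate, where the
    two conjugates act as the [i]-th and [j]-th elements. *)
Lemma shifted_product (G : set (homeo X)) (q Z : set X) (s : homeo X) (U : seq (homeo X)) :
  subgroup G -> G s -> supported q s -> Z `<=` q ->
  (forall k l x, img (s ^+ k) Z x -> img (s ^+ l) Z x -> k = l) ->
  {in U, forall u, G u /\ supported Z u} ->
  exists f, [/\ G f, supported q f & forall i j, (i < size U)%N -> (j < size U)%N -> i != j ->
    [~ f ^ (s ^+ (3 ^ j)), f ^ (s ^+ (3 ^ i))] =
    [~ nth 1 U i, nth 1 U j] ^ (s ^+ (3 ^ i + 3 ^ j))].
Proof.
move=> sG Gs sq Zq disj UP.
pose z k := img (s ^+ (3 ^ k)) Z.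
have zq k : z k `<=` q.
  by move=> x; rewrite -(img_supported (supportedX (3 ^ k) sq)); apply: imgS.
have zI k l : k != l -> z k `&` z l = set0.
  move=> kl; apply/predeqP => x; split=> // -[/= zk zl]; have := disj _ _ _ zk zl.
  by move/eqP; rewrite eqn_exp2l // (negPf kl).
pose u k := nth 1 U k ^ (s ^+ (3 ^ k)).
have UZ k : supported Z (nth 1 U k).
  have [kU|kU] := ltnP k (size U); last by rewrite nth_default.
  by have [] := UP _ (mem_nth 1 kU).
have uz k : supported (z k) (u k) by apply: supportedJ.
have Gu k : (k < size U)%N -> G (u k).
  move=> kU; apply: subgroupJ => //; last exact: subgroupX.
  by have [] := UP _ (mem_nth 1 kU).
have main m : (m <= size U)%N -> exists f,
  [/\ G f, supported q f, supported [set x | exists2 k, (k < m)%N & z k x] f &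
    forall k, (k < m)%N -> agree_on (z k) f (u k)].
  elim: m => [_|m IHm mU]; first by exists 1; split=> //; apply: subgroup1.
  have [f [Gf fq fz fu]] := IHm (ltnW mU).
  have um k : k != m -> agree_on (z k) (u m) 1.
    by move=> km; apply: agree_on_off (uz m) _; apply: zI; rewrite eq_sym.
  exists (f * u m); split.
  - by apply: subgroupM => //; apply: Gu.
  - by apply: supportedM => //; apply: supportedS (uz m); apply: zq.
  - apply: supportedM.
      by apply: supportedS fz => x [k km zk]; exists k => //; apply: ltnW.
    by apply: supportedS (uz m) => x zx; exists m.
  - move=> k; rewrite ltnS leq_eqVlt => /orP[/eqP ->|km].
      rewrite -[X in agree_on _ _ X]mul1g; apply: agree_onM; last exact: agree_on_refl.
      apply: agree_on_off fz _; apply/predeqP => x; split=> // -[[l lm zl] zm].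
      by rewrite -(zI l m); [split|rewrite ltn_eqF].
    rewrite -[u k]mulg1; apply: agree_onM; first exact: fu.
    by apply: um; rewrite ltn_eqF.
have [f [Gf fq fz fu]] := main _ (leqnn _).
exists f; split=> // i j iU jU ij.
have W k l : img (s ^+ (3 ^ l)) (z k) = img (s ^+ (3 ^ k + 3 ^ l)) Z.
  by rewrite expgnDr imgM.
have uW k l : u k ^ (s ^+ (3 ^ l)) = nth 1 U k ^ (s ^+ (3 ^ k + 3 ^ l)).
  by rewrite /u -conjgM -expgnDr.
rewrite conjRg -(uW i j) [X in nth 1 U j ^ (s ^+ X)]addnC -(uW j i).
apply: (commutator_local (W := img (s ^+ (3 ^ i + 3 ^ j)) Z) _ _ _ _
          (supportedJ fz) (supportedJ fz)).
- by rewrite -W; apply: agree_on_img; apply: fu.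
- by rewrite addnC -W; apply: agree_on_img; apply: fu.
- by rewrite uW; apply: supportedJ.
- by rewrite uW addnC; apply: supportedJ.
- move=> x [[k kU zk] [l lU zl]].
  have {}zk : img (s ^+ (3 ^ k + 3 ^ j)) Z x by rewrite -W.
  have {}zl : img (s ^+ (3 ^ l + 3 ^ i)) Z x by rewrite -W.
  by rewrite -(pow3_sidon ij (disj _ _ _ zk zl)).
Qed.

(** * Calculus of tile permutations *)

Section TilePermutations.
Variables (T : set X) (e : nat -> homeo X) (n : nat).
Hypothesis de : disjoint_tiles T e n.
Implicit Types (h : homeo X) (w : nat -> nat).

Lemma permutes_img w h i A : permutes_tiles T e n w h -> (i < n)%N -> A `<=` T ->
  img h (img (e i) A) = img (e (w i)) A.
Proof.
move=> [hE _] ni AT; rewrite -!imgM; apply/predeqP => x; split=> /imgP[a Aa <-];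
  by apply/imgP; exists a => //; rewrite !homeoM hE //; apply: AT.
Qed.

Lemma permutes_conj w h i d : permutes_tiles T e n w h -> (i < n)%N -> supported T d ->
  (d ^ e i) ^ h = d ^ e (w i).
Proof. by move=> [hE _] ni dT; rewrite -conjgM; apply: conj_agree dT _ => x; apply: hE. Qed.

Lemma permutesM w w' h h' : (forall i, (i < n)%N -> (w i < n)%N) ->
  permutes_tiles T e n w h -> permutes_tiles T e n w' h' ->
  permutes_tiles T e n (w' \o w) (h * h').
Proof.
move=> wn [hE hT] [hE' hT']; split; last exact: supportedM.
by move=> i x ni Tx; rewrite homeoM hE // hE' //; apply: wn.
Qed.

Lemma tile_disjoint i j x : (i < n)%N -> (j < n)%N -> i != j ->
  img (e i) T x -> img (e j) T x -> False.
Proof. by move=> i9 j9 ij Ti Tj; move: ij; rewrite (de i9 j9 Ti Tj) eqxx. Qed.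

Lemma tile_commute i j d d' : (i < n)%N -> (j < n)%N -> i != j ->
  supported T d -> supported T d' -> commute (d ^ e i) (d' ^ e j).
Proof.
move=> i9 j9 ij dT dT'; apply: supported_commute (supportedJ dT) (supportedJ dT') _.
by move=> x; apply: tile_disjoint.
Qed.

Lemma perm_commute i w d t : (i < n)%N -> w i = i -> permutes_tiles T e n w t ->
  supported T d -> commute (d ^ e i) t.
Proof.
move=> i9 wi tE dT; apply/commgP/conjg_fixP.
by rewrite (permutes_conj tE) // wi.
Qed.

Lemma permutes_fix w h (B : pred nat) : permutes_tiles T e n w h ->
  (forall i, (i < n)%N -> ~~ B i -> w i = i) ->
  supported [set x | exists2 i, (i < n)%N && B i & tile T e i x] h.
Proof.
move=> [hE hT] wB x Bx; have [[i ni Ti]|/hT//] := pselect (tiles T e n x).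
have [Bi|nBi] := boolP (B i); first by case: Bx; exists i => //; rewrite ni.
by move: Ti => /imgP[y Ty <-]; rewrite hE // wB.
Qed.

End TilePermutations.

(** * Absorbing the whole space *)

(** Together with [swap4] this acts transitively on the nine tiles: the cycle moves tiles 0 to 4,
    and [swap4] exchanges tiles 0 to 3 with the slots 5 to 8. *)
Definition cycle5 : nat -> nat := nth 0%N [:: 1; 2; 3; 4; 0; 5; 6; 7; 8]%N.

Definition swap4 : nat -> nat := nth 0%N [:: 5; 6; 7; 8; 4; 0; 1; 2; 3]%N.

(** Letters are applied from the head on, in accordance with products of homeomorphisms acting on
    the right. *)
Fixpoint tile_word (l : seq bool) (i : nat) : nat :=
  if l is b :: l' then tile_word l' ((if b then swap4 else cycle5) i) else i.

Lemma cycle5_lt i : (i < 9)%N -> (cycle5 i < 9)%N.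
Proof. by do 9!case: i => [|i] //. Qed.

Lemma swap4_lt i : (i < 9)%N -> (swap4 i < 9)%N.
Proof. by do 9!case: i => [|i] //. Qed.

Lemma exists_tile_word K (T : set X) e kap phi l : subgroup K -> K kap -> K phi ->
  permutes_tiles T e 9 cycle5 kap -> permutes_tiles T e 9 swap4 phi ->
  exists2 t, K t & permutes_tiles T e 9 (tile_word l) t.
Proof.
move=> sK Kk Kp ek ep; elim: l => [|b l [t Kt et]]; first by exists 1; [apply: subgroup1|].
exists ((if b then phi else kap) * t); first by apply: subgroupM => //; case: b.
by case: b; apply: permutesM et => // i; [apply: swap4_lt|apply: cycle5_lt].
Qed.

Section Core.
Variables (G : set (homeo X)) (T q : set X) (c : homeo X) (E : nat -> homeo X).
Variables kap phi al : homeo X.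
Hypotheses (sG : subgroup G) (vG : vigorous G) (simG : simple_group G).
Hypotheses (cT : clopen T) (Tc : supported T c) (c3 : c ^+ 3 = 1).
Hypotheses (qT : q `<=` T) (qc : forall x, q x -> ~ q (c x) /\ ~ q (c (c x))).
Hypothesis dE : disjoint_tiles T E 17.
Hypotheses (kE : permutes_tiles T E 9 cycle5 kap) (pE : permutes_tiles T E 9 swap4 phi).
Hypothesis alT : forall x, tiles T E 17 x -> ~ tiles T E 9 x -> tiles T E 9 (al x).

Definition Rest : set X := ~` tiles T E 17.

Lemma de9 : disjoint_tiles T E 9.
Proof. by move=> i j x i9 j9; apply: dE; apply: ltn_trans (isT : 9 < 17)%N. Qed.

Lemma tilesI i j : (i < 9)%N -> (j < 9)%N -> i != j -> img (E i) T `&` img (E j) T = set0.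
Proof.
move=> i9 j9 ij; apply/predeqP => x; split=> // -[Ti Tj].
by move: ij; rewrite (de9 i9 j9 Ti Tj) eqxx.
Qed.

Lemma Rest_tile i : (i < 9)%N -> img (E i) T `&` Rest = set0.
Proof.
move=> i9; apply/predeqP => x; split=> // -[Ti]; apply; exists i => //.
exact: ltn_trans (isT : 9 < 17)%N.
Qed.

Lemma supported_tile i d : supported T d -> supported (img (E i) T) (d ^ E i).
Proof. exact: supportedJ. Qed.

Lemma c_cubed : c^-1 * c^-1 = c.
Proof.
apply: (mulgI c); apply: (mulgI c).
by rewrite mulVKg mulgV -[RHS]/(c ^+ 3) c3.
Qed.

Section Absorb.
Variables (K : set (homeo X)) (Z : set X) (psi t : homeo X) (C : set X).
Hypotheses (sK : subgroup K) (KG : K `<=` G).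
Hypotheses (cZ : clopen Z) (Zq : Z `<=` q).

Definition Z1 : set X := img c Z.
Definition Z2 : set X := img c^-1 Z.
Definition V0 : set X := T `\` (Z `|` Z1 `|` Z2).
(* The part of the space which [psi] compresses into a slot. *)
Definition V : set X := Rest `|` img (E 5) V0.

Hypothesis psiV : supported (V `|` img (E 5) Z1) psi.
Hypotheses (CZ1 : C `<=` img (E 5) Z1) (Z1C : img (E 5) Z1 `\` C !=set0).
Hypothesis psiC : forall x, V x -> C (psi^-1 x).

Let x1 : homeo X := (c ^ E 5) ^ psi.
Let y : homeo X := x1 * (x1^-1) ^ t.
Let cc : homeo X := c ^ E 6 * (c^-1) ^ E 0.

Hypothesis tT : forall x, img (E 5) T x -> (x1 ^ t) x = x.
Hypotheses (Kk : K kap) (Kp : K phi) (Kal : K al) (Ky : K y) (Kcc : K cc).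
Hypothesis KZ : commutators_in G (img (E 0) Z) `<=` K.
Hypothesis R0 : Rest !=set0.

Lemma ZT : Z `<=` T. Proof. exact: subset_trans qT. Qed.
Lemma Z1T : Z1 `<=` T. Proof. by have := @imgS _ c _ _ ZT; rewrite (img_supported Tc). Qed.
Lemma Z2T : Z2 `<=` T.
Proof. by have := @imgS _ c^-1 _ _ ZT; rewrite (img_supported (supportedV Tc)). Qed.

Lemma Z1Z2 x : Z1 x -> Z2 x -> False.
Proof. by move=> /imgP[u Zu <-] Zcx; case: (qc (Zq Zu)) => _ nq; apply/nq/Zq. Qed.

Lemma img_cV_Z1 : img c^-1 Z1 = Z. Proof. exact: imgK. Qed.
Lemma img_cV_Z2 : img c^-1 Z2 = Z1. Proof. by rewrite /Z2 -imgM c_cubed. Qed.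

Lemma img_cV_V0 : img c^-1 V0 = V0.
Proof.
have -> : img c^-1 V0 = img c^-1 T `\` (Z2 `|` img c^-1 Z1 `|` img c^-1 Z2) by [].
rewrite img_cV_Z1 img_cV_Z2 (img_supported (supportedV Tc)) /V0.
by congr (_ `\` _); rewrite -setUA setUC.
Qed.

Lemma img_phi_tile i A : (i < 9)%N -> A `<=` T -> img phi (img (E i) A) = img (E (swap4 i)) A.
Proof. exact: permutes_img pE. Qed.

Lemma img_kap_tile i A : (i < 9)%N -> A `<=` T -> img kap (img (E i) A) = img (E (cycle5 i)) A.
Proof. exact: permutes_img kE. Qed.

Let cc5 : homeo X := cc ^ phi.

Lemma cc5E : cc5 = c ^ E 1%N * (c^-1) ^ E 5.
Proof.
rewrite /cc5 conjMg (permutes_conj pE _ Tc) //.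
by rewrite (permutes_conj pE _ (supportedV Tc)).
Qed.

Lemma img_cc5 A : A `<=` T -> img cc5 (img (E 5) A) = img (E 5) (img c^-1 A).
Proof.
move=> AT; rewrite cc5E imgM [img (c ^ E 1%N) _]img_fix ?imgJ // => x Ax.
apply: (supported_tile Tc) => T1x.
exact: disjoint_mem (tilesI _ _ _) T1x (imgS AT Ax).
Qed.

Lemma img_cc5_V A : A `<=` T -> img cc5 (V `|` img (E 5) A) = V `|` img (E 5) (img c^-1 A).
Proof.
move=> AT; rewrite !imgU !img_cc5 //; last by move=> x [].
rewrite img_cV_V0 img_fix // => x Rx; rewrite cc5E homeoM.
have fx i d : (i < 9)%N -> supported T d -> (d ^ E i) x = x.
  move=> i9 dT; apply: (supported_tile dT) => Ti.
  exact: disjoint_mem (Rest_tile i9) Ti Rx.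
by rewrite !fx //; apply: supportedV.
Qed.

Lemma clopenE i A : clopen A -> clopen (img (E i) A).
Proof. exact: clopen_img. Qed.

Lemma clopen_Rest : clopen Rest.
Proof. by apply: (clopenC set0); apply: clopen_tiles. Qed.

Lemma clopen_V : clopen V.
Proof.
apply: clopenU clopen_Rest _; apply/clopenE/clopenD => //.
by do !apply: clopenU => //; apply: clopen_img.
Qed.

(** From tile 0, [phi] brings [Z] to tile 5, and [cc5] rotates it to [Z2] and [Z1]. The escape from
    the tile is due to [y^-1]: its first factor fixes tile 5, and its second, [x1^-1], takes the
    copy of [Z2], which [psi] fixes, onto the [psi]-image of the copy of [Z1]. That image covers
    [V], because [psi^-1] maps [V] into [C], and it meets the copy of [Z1], because [C] is a proper
    part. *)
Lemma absorbs_V1 : absorbs G K (V `|` img (E 5) Z1).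
Proof.
have a0 : absorbs G K (img (E 5) Z).
  have <- : img phi (img (E 0) Z) = img (E 5) Z by apply: img_phi_tile ZT.
  by apply: absorbs_img => //; apply: absorbs_commutators.
have Kcc5 : K cc5 by apply: subgroupJ.
have a2 : absorbs G K (img (E 5) Z2).
  by rewrite /Z2 -img_cc5; [apply: absorbs_img|apply: ZT].
have a1 : absorbs G K (img (E 5) Z1).
  by rewrite -img_cV_Z2 -img_cc5; [apply: absorbs_img|apply: Z2T].
have imgy : img y^-1 (img (E 5) Z2) = img psi (img (E 5) Z1).
  have -> : y^-1 = x1 ^ t * x1^-1 by rewrite /y invgM -conjVg invgK.
  rewrite imgM (@img_fix _ _ (x1 ^ t)); last by move=> x Zx; apply: tT; apply: imgS Zx; apply: Z2T.
  have psiZ2 : img psi (img (E 5) Z2) = img (E 5) Z2.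
    apply: img_fix => x Zx; apply: psiV => -[[Rx|[_ VZ]]|Z1x].
    - exact: disjoint_mem (@Rest_tile 5 isT) (imgS Z2T Zx) Rx.
    - by apply: VZ; right.
    - exact: Z1Z2 Z1x Zx.
  by rewrite -{1}psiZ2 /x1 -!conjVg !imgJ img_cV_Z2.
have ay : absorbs G K (img psi (img (E 5) Z1)).
  by rewrite -imgy; apply: absorbs_img => //; apply: subgroupV.
have cZ1 : clopen (img (E 5) Z1) by apply/clopenE/clopen_img.
have -> : V `|` img (E 5) Z1 = img psi (img (E 5) Z1) `|` img (E 5) Z1.
  apply/predeqP => x; split=> [[Vx|]|[Px|]]; try by right.
    by left; apply: CZ1; apply: psiC.
  by apply/(supported_memV x psiV); right.
apply: absorbsU => //; first exact: clopen_img.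
have [w [Zw Cw]] := Z1C; exists (psi w); split; first exact/imgE.
have [Vpw|//] : (V `|` img (E 5) Z1) (psi w) by apply/(supported_mem w psiV); right.
by case: Cw; rewrite -(homeoK psi w); apply: psiC.
Qed.

(** The rotation [cc5] leaves [V] invariant while permuting the copies of [Z], [Z1] and [Z2], so all
    three pieces can be adjoined to [V]. *)
Lemma absorbs_Rest5 : absorbs G K (Rest `|` img (E 5) T).
Proof.
have Kcc5 : K cc5 by apply: subgroupJ.
have a1 := absorbs_V1.
have a0 : absorbs G K (V `|` img (E 5) Z).
  by rewrite -img_cV_Z1 -img_cc5_V; [apply: absorbs_img|apply: Z1T].
have a2 : absorbs G K (V `|` img (E 5) Z2).
  by rewrite -img_cc5_V; [apply: absorbs_img|apply: ZT].
have cU A : clopen A -> clopen (V `|` img (E 5) A).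
  by move=> cA; apply: clopenU clopen_V _; apply: clopenE.
have cZ1 : clopen Z1 by apply: clopen_img.
have cZ2 : clopen Z2 by apply: clopen_img.
have -> : Rest `|` img (E 5) T =
    (V `|` img (E 5) Z) `|` (V `|` img (E 5) Z1) `|` (V `|` img (E 5) Z2).
  apply/predeqP => x; split.
    case=> [Rx|Tx]; first by left; left; left; left.
    have [Zx|Zx] := pselect (img (E 5) Z x); first by left; left; right.
    have [Z1x|Z1x] := pselect (img (E 5) Z1 x); first by left; right; right.
    have [Z2x|Z2x] := pselect (img (E 5) Z2 x); first by right; right.
    by left; left; left; right; split=> // -[[]|].
  have VR : V x -> (Rest `|` img (E 5) T) x by case=> [|[]]; [left|right].
  case=> [[[/VR//|Zx]|[/VR//|Zx]]|[/VR//|Zx]]; right; apply: imgS Zx.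
  - exact: ZT.
  - exact: Z1T.
  - exact: Z2T.
have [r Rr] := R0; have Vr : V r by left.
apply: absorbsU => //; try by [apply: cU|apply: clopenU; apply: cU|].
  by exists r; split; left => //; left.
by apply: absorbsU => //; [apply: cU|apply: cU|exists r; split; left].
Qed.

Lemma img_Rest h : supported (tiles T E 9) h -> img h Rest = Rest.
Proof.
move=> hT; apply: img_fix => x Rx; apply: hT => -[i i9 Ti].
exact: disjoint_mem (Rest_tile i9) Ti Rx.
Qed.

(** Both [kap] and [phi] fix [Rest] pointwise and together reach every tile from tile 5. *)
Lemma absorbs_Rest_tile i : (i < 9)%N -> absorbs G K (Rest `|` img (E i) T).
Proof.
have aphi j : (j < 9)%N -> absorbs G K (Rest `|` img (E j) T) ->
    absorbs G K (Rest `|` img (E (swap4 j)) T).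
  move=> j9; rewrite -(img_phi_tile j9) // -{2}(img_Rest pE.2) -imgU.
  exact: absorbs_img.
have akap j : (j < 9)%N -> absorbs G K (Rest `|` img (E j) T) ->
    absorbs G K (Rest `|` img (E (cycle5 j)) T).
  move=> j9; rewrite -(img_kap_tile j9) // -{2}(img_Rest kE.2) -imgU.
  exact: absorbs_img.
have a0 := aphi 5 isT absorbs_Rest5; have a1 := akap 0%N isT a0.
have a2 := akap 1%N isT a1; have a3 := akap 2 isT a2; have a4 := akap 3 isT a3.
have a6 := aphi 1%N isT a1; have a7 := aphi 2 isT a2; have a8 := aphi 3 isT a3.
case: i => [_|[_|[_|[_|[_|[_|[_|[_|[_|//]]]]]]]]] //; exact: absorbs_Rest5.
Qed.

Lemma absorbs_tiles n : (n < 9)%N -> absorbs G K (Rest `|` tiles T E n.+1).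
Proof.
have [r Rr] := R0.
have tS m : Rest `|` tiles T E m.+1 = (Rest `|` tiles T E m) `|` (Rest `|` img (E m) T).
  apply/predeqP => x; split.
    move=> [Rx|[i im Ti]]; first by left; left.
    move: im Ti; rewrite ltnS leq_eqVlt => /orP[/eqP ->|im Ti]; first by right; right.
    by left; right; exists i.
  move=> [[Rx|[i im Ti]]|[Rx|Tm]]; try by left.
    by right; exists i => //; apply: ltnW.
  by right; exists m.
elim: n => [_|n IHn n9].
  suff -> : Rest `|` tiles T E 1 = Rest `|` img (E 0) T by apply: absorbs_Rest_tile.
  apply/predeqP => x; split=> -[Rx|Tx]; try by left.
    by case: Tx => -[|i] // _; right.
  by right; exists 0%N.
rewrite tS; apply: absorbsU => //.
- by apply: clopenU clopen_Rest _; apply: clopen_tiles.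
- by apply: clopenU clopen_Rest _; apply: clopenE.
- by exists r; split; left.
- exact/IHn/ltnW.
- exact: absorbs_Rest_tile.
Qed.

(** What remains are tiles 9 to 16. They are sent by [al] into the first nine tiles, so the preimage
    of [D] under [al] covers them. *)
Lemma absorb_all : G `<=` K.
Proof.
apply: absorbs_setT => //; pose D := Rest `|` tiles T E 9.
have aD : absorbs G K D by apply: absorbs_tiles.
have aD' : absorbs G K (img al^-1 D) by apply: absorbs_img => //; apply: subgroupV.
have cD : clopen D by apply: clopenU clopen_Rest _; apply: clopen_tiles.
suff -> : [set: X] = D `|` img al^-1 D.
  apply: absorbsU => //; first exact: clopen_img.
  have [r Rr] := R0; exists (al^-1 r); split; last by apply/imgE; left.
  (* If the preimage of [r] were outside [D], it would lie in tiles 9 to 16, and [al] would send it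
     to one of the first nine tiles instead of to [r]. *)
  apply: contrapT => nD; apply: Rr.
  have T17 : tiles T E 17 (al^-1 r) by apply: contrapT => Rr; apply: nD; left.
  have := alT T17; rewrite homeoVK => T9; have [|i i9 Ti] := T9.
    by move=> t9; apply: nD; right.
  by exists i => //; apply: ltn_trans (isT : 9 < 17)%N.
apply/predeqP => x; split=> // _.
have [T17|] := pselect (tiles T E 17 x); last by left; left.
have [T9|nT9] := pselect (tiles T E 9 x); first by left; right.
by right; right; apply: alT.
Qed.

End Absorb.
End Core.

(** * Isolating the slots *)

(** Dividing an element by its conjugate under [t] cancels every factor that commutes with [t]. With
    [t] a tile permutation fixing three slots, only the fourth slot survives. *)
Lemma subgroup_extract (gT : groupType) (H : set gT) x r t : subgroup H ->
  H (x * r) -> H t -> commute r t -> H (x * (x^-1) ^ t).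
Proof.
move=> sH Hxr Ht rt; have : H (x * r * ((x * r)^-1) ^ t).
  by apply: subgroupM => //; apply: subgroupJ => //; apply: subgroupV.
rewrite invgM conjMg; have -> : r^-1 ^ t = r^-1.
  by rewrite conjVg; congr _^-1; apply/conjg_fixP/commgP.
by rewrite mulgA mulgK.
Qed.

Section FourFactors.
Variables (gT : groupType) (H : set gT) (x y z u t : gT).
Hypotheses (sH : subgroup H) (Hxyzu : H (x * y * z * u)) (Ht : H t).

Lemma extract_first : commute y t -> commute z t -> commute u t -> H (x * (x^-1) ^ t).
Proof.
move=> yt zt ut; apply: (subgroup_extract (r := y * z * u)); rewrite ?mulgA //.
by apply/commute_sym; do !apply: commuteM; apply/commute_sym.
Qed.

Lemma extract_second : commute x y -> commute x t -> commute z t -> commute u t ->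
  H (y * (y^-1) ^ t).
Proof.
move=> xy xt zt ut; apply: (subgroup_extract (r := x * z * u)); rewrite ?mulgA -?xy //.
by apply/commute_sym; do !apply: commuteM; apply/commute_sym.
Qed.

Lemma extract_third : commute x z -> commute y z -> commute x t -> commute y t ->
  commute u t -> H (z * (z^-1) ^ t).
Proof.
move=> xz yz xt yt ut; apply: (subgroup_extract (r := x * y * u)) => //.
  by rewrite !mulgA -xz -(mulgA x) -yz mulgA.
by apply/commute_sym; do !apply: commuteM; apply/commute_sym.
Qed.

Lemma extract_fourth : commute x u -> commute y u -> commute z u ->
  commute x t -> commute y t -> commute z t -> H (u * (u^-1) ^ t).
Proof.
move=> xu yu zu xt yt zt; apply: (subgroup_extract (r := x * y * z)) => //.
  suff -> : commute u (x * y * z) by [].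
  by do !apply: commuteM; apply/commute_sym.
by apply/commute_sym; do !apply: commuteM; apply/commute_sym.
Qed.

End FourFactors.

Section SlotIsolation.
Variables (H : set (homeo X)) (T q : set X) (c s f x1 : homeo X) (E : nat -> homeo X).
Variables (kap phi : homeo X) (S : set X).
Hypotheses (sH : subgroup H) (Tc : supported T c) (qT : q `<=` T).
Hypothesis qc : forall x, q x -> ~ q (c x) /\ ~ q (c (c x)).
Hypotheses (qs : supported q s) (qf : supported q f).
Hypotheses (dE : disjoint_tiles T E 9) (Hk : H kap) (Hp : H phi).
Hypotheses (kE : permutes_tiles T E 9 cycle5 kap) (pE : permutes_tiles T E 9 swap4 phi).
Hypothesis Sx1 : supported (S `|` img (E 5) T) x1.
Hypothesis ST : S `&` tiles T E 9 = set0.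
Hypothesis Hchi : H (x1 * c ^ E 6 * (c ^ s) ^ E 7 * (c ^ f) ^ E 8).

Lemma tile_commute_x1 i d : (i < 9)%N -> i != 5 -> supported T d -> commute x1 (d ^ E i).
Proof.
move=> i9 i5 dT; apply: supported_commute Sx1 (supportedJ dT) _ => x [Sx|T5x] Tx.
  by apply: disjoint_mem ST Sx _; exists i.
exact: (tile_disjoint dE i9 (isT : 5 < 9)%N i5 Tx T5x).
Qed.

Lemma perm_commute_x1 w t : w 5 = 5 -> permutes_tiles T E 9 w t -> commute x1 t.
Proof.
move=> w5 tE.
have tS : supported [set x | exists2 i, (i < 9)%N && (i != 5) & tile T E i x] t.
  by apply: permutes_fix tE _ => i _; rewrite negbK => /eqP ->.
apply: supported_commute Sx1 tS _ => x [Sx|T5x] [i /andP[i9 i5] Ti].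
  by apply: disjoint_mem ST Sx _; exists i.
exact: (tile_disjoint dE i9 (isT : 5 < 9)%N i5 Ti T5x).
Qed.

Let Ts : supported T s. Proof. exact: supportedS qs. Qed.
Let Tf : supported T f. Proof. exact: supportedS qf. Qed.
Let Tcs : supported T (c ^ s).
Proof. by apply: supported_conj Tc; rewrite (img_supported Ts). Qed.
Let Tcf : supported T (c ^ f).
Proof. by apply: supported_conj Tc; rewrite (img_supported Tf). Qed.

Lemma extract_x1 w t : H t -> permutes_tiles T E 9 w t -> w 6 = 6 -> w 7 = 7 -> w 8 = 8 ->
  H (x1 * (x1^-1) ^ t).
Proof. by move=> Ht tE w6 w7 w8; apply: (extract_first sH Hchi Ht); apply: perm_commute tE _. Qed.

Lemma extract_c w t : H t -> permutes_tiles T E 9 w t -> w 5 = 5 -> w 7 = 7 -> w 8 = 8 ->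
  w 6 = 0%N -> H (c ^ E 6 * (c^-1) ^ E 0).
Proof.
move=> Ht tE w5 w7 w8 w6; have -> : c^-1 ^ E 0 = ((c ^ E 6)^-1) ^ t.
  by rewrite -(conjVg _ (E 6)) (permutes_conj tE) ?w6 //; apply: supportedV.
apply: (extract_second sH Hchi Ht); try exact: perm_commute tE _.
  exact: tile_commute_x1.
exact: perm_commute_x1 tE.
Qed.

Lemma extract_cs w t : H t -> permutes_tiles T E 9 w t -> w 5 = 5 -> w 6 = 6 -> w 8 = 8 ->
  w 7 = 0%N -> H ((c ^ s) ^ E 7 * ((c ^ s)^-1) ^ E 0).
Proof.
move=> Ht tE w5 w6 w8 w7; have -> : (c ^ s)^-1 ^ E 0 = (((c ^ s) ^ E 7)^-1) ^ t.
  by rewrite -(conjVg _ (E 7)) (permutes_conj tE) ?w7 //; apply: supportedV.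
apply: (extract_third sH Hchi Ht); try exact: perm_commute tE _.
- exact: tile_commute_x1.
- exact: (tile_commute dE).
- exact: perm_commute_x1 tE.
Qed.

Lemma extract_cf w t : H t -> permutes_tiles T E 9 w t -> w 5 = 5 -> w 6 = 6 -> w 7 = 7 ->
  w 8 = 0%N -> H ((c ^ f) ^ E 8 * ((c ^ f)^-1) ^ E 0).
Proof.
move=> Ht tE w5 w6 w7 w8; have -> : (c ^ f)^-1 ^ E 0 = (((c ^ f) ^ E 8)^-1) ^ t.
  by rewrite -(conjVg _ (E 8)) (permutes_conj tE) ?w8 //; apply: supportedV.
apply: (extract_fourth sH Hchi Ht); try exact: perm_commute tE _.
- exact: tile_commute_x1.
- exact: (tile_commute dE).
- exact: (tile_commute dE).
- exact: perm_commute_x1 tE.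
Qed.

(** * Recovering commutators of shifted copies of [f] *)

Let p : set X := img c^-1 q.
Let r : set X := img c q.

Lemma q_r_disjoint x : q x -> r x -> False.
Proof. by move=> qx /imgP[u qu e]; case: (qc qu); rewrite e. Qed.

Lemma q_p_disjoint x : q x -> p x -> False.
Proof. by move=> qx qcx; case: (qc qx). Qed.

Lemma p_r_disjoint x : p x -> r x -> False.
Proof. by move=> qcx /imgP[u qu e]; case: (qc qu) => _; rewrite e. Qed.

Lemma p_T : p `<=` T.
Proof. by have := @imgS _ c^-1 _ _ qT; rewrite (img_supported (supportedV Tc)). Qed.

Lemma r_T : r `<=` T.
Proof. by have := @imgS _ c _ _ qT; rewrite (img_supported Tc). Qed.

(** Written as [(g^-1) ^ c * g], the commutator is [g] on [q] and an inverse copy of [g] on [r],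
    leaving the third translate [p] alone. *)
Lemma commutator_c g : supported q g ->
  [/\ supported (q `|` r) [~ c, g], agree_on q [~ c, g] g & preserves p [~ c, g]].
Proof.
move=> qg; rewrite commgEr.
have rg : supported r (g^-1 ^ c) by apply/supportedJ/supportedV.
split.
- by apply: supportedM; [apply: supportedS rg|apply: supportedS qg]; [right|left].
- rewrite -[X in agree_on _ _ X]mul1g; apply: agree_onM; last exact: agree_on_refl.
  by apply: agree_on_off rg _; apply/predeqP => x; split=> // -[rx qx]; case: (q_r_disjoint qx rx).
- apply: preservesM.
    by apply: preserves_off rg _; apply/predeqP => x; split=> // -[rx px]; case: (p_r_disjoint px rx).
  by apply: preserves_off qg _; apply/predeqP => x; split=> // -[qx px]; case: (q_p_disjoint qx px).
Qed.

(** With [c^-1] in place of [c] the inverse copy sits on [p], which is disjoint from [r]. *)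
Lemma commutator_cV g : supported q g ->
  [/\ supported (q `|` p) [~ c^-1, g] & agree_on q [~ c^-1, g] g].
Proof.
move=> qg; rewrite commgEr.
have pg : supported p (g^-1 ^ c^-1) by apply/supportedJ/supportedV.
split.
- by apply: supportedM; [apply: supportedS pg|apply: supportedS qg]; [right|left].
- rewrite -[X in agree_on _ _ X]mul1g; apply: agree_onM; last exact: agree_on_refl.
  by apply: agree_on_off pg _; apply/predeqP => x; split=> // -[px qx]; case: (q_p_disjoint qx px).
Qed.

(* Only the factor [h], which acts on tile 0, matters; [g] and [k] end up being
   disposed of in a commutator. *)
Let three g h k i j : homeo X := g ^ E i * h ^ E 0 * k ^ E j.

Lemma agree_on_tile0 i A d : (0 < i < 9)%N -> supported T d -> A `<=` T ->
  agree_on (img (E 0) A) (d ^ E i) 1.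
Proof.
move=> /andP[i0 i9] dT AT; apply: agree_on_off (supportedJ dT) _.
apply/predeqP => x; split=> // -[Ti Ax]; apply: (@tile_disjoint T E 9 dE i 0 x) => //.
  by rewrite -lt0n.
exact: imgS Ax.
Qed.

Lemma three_agree g h h' k i j : (0 < i < 9)%N -> (0 < j < 9)%N -> supported T g ->
  supported T k -> agree_on q h h' -> agree_on (img (E 0) q) (three g h k i j) (h' ^ E 0).
Proof.
move=> i9 j9 gT kT hh'; rewrite -[h' ^ E 0]mul1g -[1 * _]mulg1.
apply: agree_onM; last exact: agree_on_tile0.
by apply: agree_onM; [apply: agree_on_tile0|apply: agree_on_img].
Qed.

Lemma three_supported g h k i j A : supported T g -> supported T k -> supported A h ->
  supported (img (E 0) A `|` (img (E i) T `|` img (E j) T)) (three g h k i j).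
Proof.
move=> gT kT hA; apply: supportedM; first apply: supportedM.
- by apply: supportedS (supportedJ gT) => x Tx; right; left.
- by apply: supportedS (supportedJ hA) => x Tx; left.
- by apply: supportedS (supportedJ kT) => x Tx; right; right.
Qed.

Lemma tile_preserves i j d : (i < 9)%N -> (j < 9)%N -> supported T d ->
  preserves (img (E j) T) (d ^ E i).
Proof.
move=> i9 j9 dT; have [<-|ij] := eqVneq i j; first exact/preserves_supported/supportedJ.
apply: preserves_off (supportedJ dT) _; apply/predeqP => x; split=> // -[Ti Tj].
exact: (tile_disjoint dE i9 j9 ij Ti Tj).
Qed.

Lemma three_preserves g h k i j l : (i < 9)%N -> (j < 9)%N -> (l < 9)%N ->
  supported T g -> supported T h -> supported T k ->
  preserves (img (E l) T) (three g h k i j).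
Proof.
move=> i9 j9 l9 gT hT kT.
by apply: preservesM; [apply: preservesM|]; apply: tile_preserves.
Qed.

Lemma three_preserves0 g h k i j A : (0 < i < 9)%N -> (0 < j < 9)%N -> A `<=` T ->
  supported T g -> supported T k -> preserves A h ->
  preserves (img (E 0) A) (three g h k i j).
Proof.
move=> i9 j9 AT gT kT hA; apply: preservesM; [apply: preservesM|];
  try by apply: agree_on_preserves; apply: agree_on_tile0.
by move=> x; rewrite homeoJ imgE hA.
Qed.

Let word l : exists2 t, H t & permutes_tiles T E 9 (tile_word l) t.
Proof. exact: exists_tile_word Hk Hp kE pE. Qed.

(* The words below were found by a search in the group of tile permutations;
   [true] stands for [swap4] and [false] for [cycle5]. *)
Lemma extract_cc : H (c ^ E 6 * (c^-1) ^ E 0).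
Proof.
have [t Ht tE] := word [:: true; false; false; false; true; false; true; false; false; true].
exact: extract_c Ht tE _ _ _ _.
Qed.

Let Hcs : H ((c ^ s) ^ E 7 * ((c ^ s)^-1) ^ E 0).
Proof.
have [t Ht tE] := word [:: true; false; false; true; false; true; false; false; false; true].
exact: extract_cs Ht tE _ _ _ _.
Qed.

Let Hcf : H ((c ^ f) ^ E 8 * ((c ^ f)^-1) ^ E 0).
Proof.
have [t Ht tE] := word [:: true; false; true; false; true; false; false; false; false; true].
exact: extract_cf Ht tE _ _ _ _.
Qed.

(** A substitute for the shift: on [q] in tile 0 it acts as [s]. It is a quotient of the elements
    isolated from slots 6 and 7, whose tile 0 parts combine to [c^-1 * c ^ s]. *)
Let A : homeo X := three c [~ c, s] (c ^ s)^-1 6 7.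

Let mul4 (gT : groupType) (a b d e : gT) : a * b * (d * e) = a * (b * d) * e.
Proof. by rewrite !mulgA. Qed.

Let HA : H A.
Proof.
have := subgroupM sH extract_cc (subgroupV sH Hcs).
have -> : ((c ^ s) ^ E 7 * ((c ^ s)^-1) ^ E 0)^-1 = (c ^ s) ^ E 0 * ((c ^ s)^-1) ^ E 7.
  by rewrite invgM -(conjVg _ (E 0)) invgK -(conjVg _ (E 7)).
by rewrite mul4 -conjMg -commgEl.
Qed.

(** A substitute for [f] on [q] in tile 0, with side effects on [p] and on tiles 6 and 8. *)
Let B : homeo X := three c^-1 [~ c^-1, f] (c ^ f) 6 8.

Let HB : H B.
Proof.
have := subgroupM sH (subgroupV sH extract_cc) Hcf.
have -> : (c ^ E 6 * (c^-1) ^ E 0)^-1 = (c^-1) ^ E 6 * c ^ E 0.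
  rewrite invgM -!conjVg invgK; apply: (tile_commute dE) => //; exact: supportedV.
have -> : (c ^ f) ^ E 8 * ((c ^ f)^-1) ^ E 0 = ((c ^ f)^-1) ^ E 0 * (c ^ f) ^ E 8.
  apply: (tile_commute dE) => //; exact: supportedV.
by rewrite mul4 -conjMg; have -> : c * (c ^ f)^-1 = [~ c^-1, f] by rewrite commgEl invgK conjVg.
Qed.

(** A second substitute for [f] whose side effects, on [r] and on tiles 1 and 2, are disjoint from
    those of [B]. The word used below fixes tile 0 and moves tiles 6 and 8 to 1 and 2. *)
Let B' : homeo X := three c [~ c, f] (c ^ f)^-1 1 2.

Let HB' : H B'.
Proof.
have [t Ht tE] := word [:: false; false; true; false; true; false; true; false; false;
                           true; false; false].
have := subgroupJ sH (subgroupM sH extract_cc (subgroupV sH Hcf)) Ht.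
have -> : ((c ^ f) ^ E 8 * ((c ^ f)^-1) ^ E 0)^-1 = (c ^ f) ^ E 0 * ((c ^ f)^-1) ^ E 8.
  by rewrite invgM -(conjVg _ (E 0)) invgK -(conjVg _ (E 8)).
rewrite mul4 -conjMg -commgEl.
have -> x y z : (x * y * z) ^ t = x ^ t * y ^ t * z ^ t by rewrite !conjMg.
rewrite !(permutes_conj tE) //; first exact: supportedV.
by apply: supportedR.
Qed.

Let Aq : agree_on (img (E 0) q) A (s ^ E 0).
Proof. by apply: three_agree => //; [apply: supportedV|have [] := commutator_c qs]. Qed.

(** On [q] in tile 0 the power [A ^+ n] acts as the shift does, so conjugating by its inverse undoes
    the shift. *)
Lemma extract_unshift d n : supported q d -> H ((d ^ (s ^+ n)) ^ E 0) -> H (d ^ E 0).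
Proof.
move=> qd Hd; have := subgroupJ sH Hd (subgroupV sH (subgroupX n sH HA)).
suff -> : ((d ^ (s ^+ n)) ^ E 0) ^ (A ^+ n)^-1 = d ^ E 0 by [].
apply: canLR (conjgKV _) _; rewrite conjJg conjXg.
by apply/esym; apply: agree_on_conj_eq (supportedJ qd) _; apply: agree_onX.
Qed.

(** The supports of [B] and [B'] meet only within [q] in tile 0, and [A] preserves the sets that
    bound them. So after conjugation by powers of [A] the commutator depends only on the action on
    [q], where these elements act as [f] and [s]. *)
Lemma extract_commutators m n : H ([~ f ^ (s ^+ m), f ^ (s ^+ n)] ^ E 0).
Proof.
have [suppA _ pA] := commutator_c qs.
have [suppB aB] := commutator_cV qf; have [suppB' aB' _] := commutator_c qf.
have cV : supported T c^-1 by apply: supportedV.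
have csV : supported T (c ^ s)^-1 by apply: supportedV.
have cfV : supported T (c ^ f)^-1 by apply: supportedV.
have qpT : q `|` p `<=` T by move=> x [/qT|/p_T].
have qrT : q `|` r `<=` T by move=> x [/qT|/r_T].
have sR : supported T [~ c, s] by apply: supportedR.
pose SB := img (E 0) (q `|` p) `|` (img (E 6) T `|` img (E 8) T).
pose SB' := img (E 0) (q `|` r) `|` (img (E 1) T `|` img (E 2) T).
have presT l : (l < 9)%N -> preserves (img (E l) T) A by move=> l9; apply: three_preserves.
have presB : preserves SB A.
  apply: preservesU; last by apply: preservesU; apply: presT.
  apply: three_preserves0 => //; apply: preservesU pA.
  by apply: agree_on_preserves; have [_ aA _] := commutator_c qs; apply: aA.
have presB' : preserves SB' A.
  apply: preservesU; last by apply: preservesU; apply: presT.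
  by apply: three_preserves0 => //; apply: preserves_supported.
have Bm : supported SB (B ^ (A ^+ m)).
  apply: (supported_conj (A := SB)); last exact: three_supported.
  by rewrite preserves_img //; apply: preservesX.
have Bn : supported SB' (B' ^ (A ^+ n)).
  apply: (supported_conj (A := SB')); last exact: three_supported.
  by rewrite preserves_img //; apply: preservesX.
have sE g k : (g ^ (s ^+ k)) ^ E 0 = (g ^ E 0) ^ ((s ^ E 0) ^+ k) by rewrite conjJg conjXg.
have fq k : supported q (f ^ (s ^+ k)).
  by apply: (supported_conj _ qf); rewrite (img_supported (supportedX k qs)).
have -> : [~ f ^ (s ^+ m), f ^ (s ^+ n)] ^ E 0 = [~ B ^ (A ^+ m), B' ^ (A ^+ n)].
  apply/esym; rewrite conjRg; apply: (commutator_local (W := img (E 0) q) _ _ _ _ Bm Bn).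
  - by rewrite sE; apply: agree_onJ; [apply: three_agree|apply: agree_onX].
  - by rewrite sE; apply: agree_onJ; [apply: three_agree|apply: agree_onX].
  - exact: supportedJ.
  - exact: supportedJ.
  move=> x [[Bx|[Bx|Bx]] [B'x|[B'x|B'x]]];
    try by case: (@tile_disjoint T E 9 dE _ _ x _ _ _ Bx B'x).
  - case: Bx B'x => [//|px] [//|rx]; case: (p_r_disjoint px rx).
  - by case: (@tile_disjoint T E 9 dE 0 1 x isT isT isT (imgS qpT Bx) B'x).
  - by case: (@tile_disjoint T E 9 dE 0 2 x isT isT isT (imgS qpT Bx) B'x).
  - by case: (@tile_disjoint T E 9 dE 6 0 x isT isT isT Bx (imgS qrT B'x)).
  - by case: (@tile_disjoint T E 9 dE 8 0 x isT isT isT Bx (imgS qrT B'x)).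
by apply: subgroupR => //; apply: subgroupJ => //; apply: subgroupX.
Qed.

End SlotIsolation.

(** * The element of order 30 *)

Definition kap17 : nat -> nat :=
  nth 0%N [:: 1; 2; 3; 4; 0; 5; 6; 7; 8; 9; 10; 11; 12; 13; 14; 15; 16]%N.

(** The swaps are arranged so that renaming tiles by [copied] turns them into [swap4]; tiles 5 to 8
    are left to [chi]. *)
Definition phi17 : nat -> nat :=
  nth 0%N [:: 0; 1; 2; 3; 4; 5; 6; 7; 8; 13; 14; 15; 16; 9; 10; 11; 12]%N.

(* Tiles 9, ..., 16 are copies of the tiles 0, ..., 8 other than 4. *)
Definition copied : nat -> nat :=
  nth 0%N [:: 0; 0; 0; 0; 0; 0; 0; 0; 0; 0; 1; 2; 3; 5; 6; 7; 8]%N.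

(** A right inverse of [copied] away from 4; the entry at 4 is a dummy, since tile 4 has no copy. *)
Definition copy : nat -> nat := nth 0%N [:: 9; 10; 11; 12; 0; 13; 14; 15; 16]%N.

Section Configuration.
Variables (T : set X) (c : homeo X) (e : nat -> homeo X) (kap phi : homeo X).
Hypotheses (Tc : supported T c) (c3 : c ^+ 3 = 1) (T0 : T !=set0).
Hypothesis de : disjoint_tiles T e 17.
Hypotheses (kE : permutes_tiles T e 17 kap17 kap) (pE : permutes_tiles T e 17 phi17 phi).

Lemma permutes_eq w w' n h : (forall i, (i < n)%N -> w i = w' i) ->
  permutes_tiles T e n w h -> permutes_tiles T e n w' h.
Proof. by move=> ww' [hE hT]; split=> // i x ni Tx; rewrite hE // ww'. Qed.

Lemma permutes_id w n h : (forall i, (i < n)%N -> w i = i) ->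
  permutes_tiles T e n w h -> h = 1.
Proof.
move=> wi [hE hT]; apply: homeo_ext => x.
have [[i ni /imgP[y Ty <-]]|/hT//] := pselect (tiles T e n x).
by rewrite hE // wi.
Qed.

Lemma permutes_neq1 w n h i : disjoint_tiles T e n -> (i < n)%N -> (w i < n)%N -> w i != i ->
  permutes_tiles T e n w h -> h <> 1.
Proof.
move=> dn ni nwi /eqP wi [hE _] h1; apply: wi; have [y Ty] := T0.
apply: (dn _ _ (e i y)) => //; last exact/imgE.
by apply/imgP; exists y => //; rewrite -hE // h1.
Qed.

Lemma kap_support :
  supported [set x | exists2 i, (i < 17)%N && (i < 5)%N & tile T e i x] kap.
Proof. by apply: permutes_fix kE _; do 17!(case=> [|i] //; move: i). Qed.

Lemma phi_support :
  supported [set x | exists2 i, (i < 17)%N && (9 <= i)%N & tile T e i x] phi.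
Proof. by apply: permutes_fix pE _; do 17!(case=> [|i] //; move: i). Qed.

Definition chi : homeo X := c ^ e 5 * c ^ e 6 * c ^ e 7 * c ^ e 8.

Lemma phi_kap_commute : commute phi kap.
Proof.
apply: supported_commute phi_support kap_support _ => x [i /andP[i17 i9] Ti] [j /andP[j17 j5] Tj].
by move: i9; rewrite (de i17 j17 Ti Tj) leqNgt (ltn_trans j5).
Qed.

Lemma chi_commute w h : w 5 = 5 -> w 6 = 6 -> w 7 = 7 -> w 8 = 8 ->
  permutes_tiles T e 17 w h -> commute h chi.
Proof.
move=> w5 w6 w7 w8 hE; have cm i : (i < 17)%N -> w i = i -> commute h (c ^ e i).
  by move=> i17 wi; apply/commute_sym; apply: perm_commute hE Tc.
by apply: commuteM; [apply: commuteM; [apply: commuteM|]|]; apply: cm.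
Qed.

Lemma permutes_iter w n h k : (forall i, (i < n)%N -> (w i < n)%N) ->
  permutes_tiles T e n w h -> permutes_tiles T e n (iter k w) (h ^+ k).
Proof.
move=> wn [hE hT]; split; last exact: supportedX.
elim: k => [|k IHk] i x ni Tx; first by rewrite expg0.
rewrite expgSr homeoM IHk //= hE //.
by elim: k {IHk} => //= k; apply: wn.
Qed.

Lemma kap_order : kap ^+ 5 = 1.
Proof.
apply: (@permutes_id _ 17 _ _ (permutes_iter 5 _ kE)); by do 17!(case=> [|i] //; move: i).
Qed.

Lemma phi_order : phi ^+ 2 = 1.
Proof.
apply: (@permutes_id _ 17 _ _ (permutes_iter 2 _ pE)); by do 17!(case=> [|i] //; move: i).
Qed.

Lemma chi_order : chi ^+ 3 = 1.
Proof.
have cm i j : (i < 17)%N -> (j < 17)%N -> i != j -> commute (c ^ e i) (c ^ e j).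
  by move=> *; apply: (tile_commute de).
have cM i j k : (i < 17)%N -> (j < 17)%N -> (k < 17)%N -> i != j -> i != k ->
    commute (c ^ e j * c ^ e k) (c ^ e i).
  by move=> *; apply/commute_sym; apply: commuteM; apply: cm.
have c1 i : (c ^ e i) ^+ 3 = 1 by rewrite -conjXg c3 conj1g.
rewrite /chi expgMn.
  rewrite expgMn; last exact: cM.
  by rewrite expgMn ?c1 ?mulg1 //; apply: cm.
by apply/commute_sym; apply: commuteM; [apply/commute_sym; apply: cM|apply: cm].
Qed.

Lemma sigma_order : c <> 1 -> has_order (phi * kap * chi) 30.
Proof.
move=> c1; apply: has_order_30.
- exact: phi_kap_commute.
- exact: chi_commute pE.
- exact: chi_commute kE.
- exact: phi_order.
- exact: kap_order.
- exact: chi_order.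
- exact: (@permutes_neq1 phi17 17 phi 9).
- exact: (@permutes_neq1 kap17 17 kap 0).
(* On tile 5 only the first factor of [chi] acts, so triviality of [chi] would make [c] trivial. *)
move=> chi1; apply: c1; apply: (@conjg_inj _ (e 5)); rewrite conj1g.
apply: homeo_ext => x; have [Tx|Tx] := pselect (tile T e 5 x); last first.
  by rewrite (supportedJ (g := e 5) Tc).
have off i y : (i < 17)%N -> i != 5 -> tile T e 5 y -> (c ^ e i) y = y.
  move=> i17 i5 Ty; apply: (supportedJ Tc) => Ti.
  exact: (tile_disjoint de i17 (isT : 5 < 17)%N i5 Ti Ty).
have T5 : tile T e 5 ((c ^ e 5) x) by apply/(supported_mem _ (supportedJ (g := e 5) Tc)).
have : chi x = x by rewrite chi1.
have chiE : chi x = (c ^ e 8) ((c ^ e 7) ((c ^ e 6) ((c ^ e 5) x))) by [].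
by rewrite chiE (off 6) // (off 7) // (off 8).
Qed.

Lemma sigma_powers :
  [/\ (phi * kap * chi) ^+ 15 = phi, (phi * kap * chi) ^+ 6 = kap &
      (phi * kap * chi) ^+ 10 = chi].
Proof.
have [||||||[p15 p6 p10 _]] := @three_commuting_powers _ phi kap chi => //.
- exact: phi_kap_commute.
- exact: chi_commute pE.
- exact: chi_commute kE.
- exact: phi_order.
- exact: kap_order.
- exact: chi_order.
Qed.

End Configuration.

Lemma permutes_translate T e n w h g : permutes_tiles T e n w h ->
  permutes_tiles T (fun i => e i * g) n w (h ^ g).
Proof.
move=> [hE hT]; split=> [i x ni Tx|x Tx].
  by rewrite homeoJ !homeoM homeoK hE.
rewrite homeoJ hT ?homeoVK // => -[i ni Ti]; apply: Tx; exists i => //.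
Qed.

(** * Placing the tiles *)

Section Placement.
Variable G : set (homeo X).
Hypotheses (sG : subgroup G) (vG : vigorous G) (simG : simple_group G).

(** All the sets come from a point moved by [al]: [W] is near its image, the preimage of [W] is near
    the point itself, and [O] and [J] avoid both. *)
Lemma disjoint_targets (al : homeo X) (M : set X) : al <> 1 -> clopen M -> M !=set0 ->
  exists W O J : set X, [/\ clopen W, clopen O & clopen J] /\
    [/\ W !=set0, O !=set0 & J !=set0] /\
    [/\ J `<=` M, W `&` O = set0 & img al^-1 W `&` O = set0] /\
    [/\ img al^-1 W `&` W = set0, J `&` W = set0, J `&` O = set0 & J `&` img al^-1 W = set0].
Proof.
move=> al1 cM M0; have [x alx] : exists x, al x <> x.
  apply: contrapT => nx; apply: al1; apply: homeo_ext => x.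
  by apply: contrapT => alx; apply: nx; exists x.
have inv (y z : X) s : y \notin z :: s -> y <> z /\ y \notin s.
  by rewrite in_cons negb_or => /andP[/eqP].
have out (y z : X) s : y <> z -> y \notin s -> y \notin z :: s.
  by rewrite in_cons negb_or => /eqP ->.
have [j Mj /inv[jx /inv[jax _]]] := clopen_infinite [:: x; al x] cM M0.
have [o _ /inv[ox /inv[oax /inv[oj _]]]] :=
  clopen_infinite [:: x; al x; j] clopenT (ex_intro _ x I).
have avoid (z : X) (s : seq X) : z \notin s ->
    exists N, [/\ clopen N, N z & forall y, y \in s -> ~ N y] by apply: clopen_avoid.
have sym (y z : X) : y <> z -> z <> y by move=> yz /esym.
have [N1 [cN1 N1x N1P]] := avoid x [:: al x; j; o]
  (out _ _ _ (sym _ _ alx) (out _ _ _ (sym _ _ jx) (out _ _ [::] (sym _ _ ox) isT))).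
have [N2 [cN2 N2x N2P]] := avoid (al x) [:: x; j; o]
  (out _ _ _ alx (out _ _ _ (sym _ _ jax) (out _ _ [::] (sym _ _ oax) isT))).
have [N3 [cN3 N3o N3P]] := avoid o [:: x; al x; j]
  (out _ _ _ ox (out _ _ _ oax (out _ _ [::] oj isT))).
pose W := img al N1 `&` (N2 `\` N1); pose O := N3 `\` (N1 `|` N2).
pose J := M `\` (N1 `|` N2 `|` N3).
have WN1 y : img al^-1 W y -> N1 y by case=> /imgE.
exists W, O, J; split; [split|split; [split|split; split]].
- by apply: clopenI; [apply: clopen_img|apply: clopenD].
- by apply: clopenD => //; apply: clopenU.
- by apply: clopenD => //; do !apply: clopenU.
- exists (al x); split; first exact/imgE.
  by split=> //; apply: N1P; rewrite !in_cons eqxx.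
- exists o; split=> // -[|]; first by apply: N1P; rewrite !in_cons eqxx !orbT.
  by apply: N2P; rewrite !in_cons eqxx !orbT.
- exists j; split=> // -[[|]|].
  + by apply: N1P; rewrite !in_cons eqxx !orbT.
  + by apply: N2P; rewrite !in_cons eqxx !orbT.
  + by apply: N3P; rewrite !in_cons eqxx !orbT.
- by move=> y [].
- by apply/predeqP => y; split=> // -[[_ [N2y _]] [_]]; apply; right.
- by apply/predeqP => y; split=> // -[/WN1 N1y [_]]; apply; left.
- by apply/predeqP => y; split=> // -[/WN1 N1y [_ [_]]].
- by apply/predeqP => y; split=> // -[[_ nN] [_ [N2y _]]]; apply: nN; left; right.
- by apply/predeqP => y; split=> // -[[_ nN] [N3y _]]; apply: nN; right.
- by apply/predeqP => y; split=> // -[[_ nN] /WN1 N1y]; apply: nN; left; left.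
Qed.

Lemma placement (T : set X) (e : nat -> homeo X) (M : set X) (al : homeo X) :
  clopen T -> (forall i, G (e i)) -> disjoint_tiles T e 17 -> clopen M -> M !=set0 ->
  M `&` tiles T e 17 = set0 -> G al -> al <> 1 ->
  exists2 g, G g & forall k x, (9 <= k < 17)%N -> T x ->
    al (g (e k x)) = g (e (copied k) x).
Proof.
move=> cT Ge de cM M0 MT Gal al1.
have [W [O [J [[cW cO cJ] [[W0 O0 J0] [[JM WO VO] [VW JW JO JV]]]]]]] :=
  disjoint_targets al1 cM M0.
have ctT : clopen (tiles T e 17) by apply: clopen_tiles.
have tN : [set: X] `\` tiles T e 17 !=set0.
  by have [m Mm] := M0; exists m; split=> // Tm; apply: disjoint_mem MT Mm Tm.
have push C : clopen C -> C !=set0 ->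
    exists2 v, G v & forall i x, (i < 17)%N -> T x -> C (v (e i x)).
  move=> cC C0; have [||v [Gv _ vC]] := vigorous_push sG vG clopenT ctT cC _ tN _ C0 => //.
  by exists v => // i x i17 Tx; apply: vC; exists i => //; apply/imgE.
have [v1 Gv1 v1W] := push W cW W0; have [v2 Gv2 v2O] := push O cO O0.
(* The eight tiles to be copied go into [W], tile 4 into [O], and each tile from 9 on is defined as
   the preimage under [al] of the new position of the tile it copies. *)
pose e' i := if i == 4 then e 4 * v2 else
  if (i < 9)%N then e i * v1 else e (copied i) * v1 * al^-1.
have cop i : (9 <= i < 17)%N -> (copied i < 9)%N && (copied i != 4).
  by do 17!(case: i => [|i] //).
have copI i j : (9 <= i < 17)%N -> (9 <= j < 17)%N -> copied i = copied j -> i = j.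
  have copK k : (9 <= k < 17)%N -> copy (copied k) = k by do 17!(case: k => [|k] //).
  by move=> i17 j17 e0; rewrite -(copK i) // e0 copK.
have region i x : (i < 17)%N -> tile T e' i x ->
    [\/ i = 4 /\ O x, (i < 9)%N /\ W x | (9 <= i)%N /\ img al^-1 W x].
  move=> i17 /imgP[y Ty <-]; rewrite /e'; have [->|i4] := eqVneq i 4.
    by apply: Or31; split=> //; apply: v2O.
  case: ltnP => i9; first by apply: Or32; split=> //; apply: v1W.
  apply: Or33; split=> //; apply/imgE; apply: v1W => //.
  have /cop/andP[c9 _] : (9 <= i < 17)%N by rewrite i9.
  exact: ltn_trans c9 _.
have lt9 i : (i < 9)%N -> (i < 17)%N by move=> i9; apply: ltn_trans i9 _.
have de' : disjoint_tiles T e' 17.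
  move=> i j x i17 j17 Ti Tj.
  have [[ei Ox]|[i9 Wx]|[i9 Vx]] := region _ _ i17 Ti;
    have [[ej Ox']|[j9 Wx']|[j9 Vx']] := region _ _ j17 Tj;
    try by [rewrite ei ej
           |case: (disjoint_mem WO Wx Ox')|case: (disjoint_mem WO Wx' Ox)
           |case: (disjoint_mem VO Vx Ox')|case: (disjoint_mem VO Vx' Ox)
           |case: (disjoint_mem VW Vx Wx')|case: (disjoint_mem VW Vx' Wx)].
  - have i4 : i != 4.
      apply/eqP => i4; move: Ti; rewrite /tile /e' i4 eqxx => /imgP[y Ty ey].
      by apply: (disjoint_mem WO Wx); rewrite -ey; apply: v2O.
    have j4 : j != 4.
      apply/eqP => j4; move: Tj; rewrite /tile /e' j4 eqxx => /imgP[y Ty ey].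
      by apply: (disjoint_mem WO Wx); rewrite -ey; apply: v2O.
    move: Ti Tj; rewrite /tile /e' (negPf i4) (negPf j4) i9 j9 !imgM.
    by apply: de; apply: lt9.
  - move: Ti Tj; rewrite /tile /e' !ifN -?leqNgt //; try by apply/eqP => e4; rewrite e4 in i9 j9.
    have ci : (9 <= i < 17)%N by rewrite i9.
    have cj : (9 <= j < 17)%N by rewrite j9.
    rewrite !imgM => Ti Tj; apply: copI => //; apply: de Ti Tj; apply: lt9.
      by case/andP: (cop _ ci).
    by case/andP: (cop _ cj).
have Ge' i : G (e' i).
  rewrite /e'; case: ifP => _; first exact: subgroupM.
  case: ifP => _; first exact: subgroupM.
  by apply: subgroupM; [|apply: subgroupM|apply: subgroupV].
have JT : J `&` tiles T e 17 = set0.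
  by apply/predeqP => x; split=> // -[/JM Mx Tx]; apply: disjoint_mem MT Mx Tx.
have JT' : J `&` tiles T e' 17 = set0.
  apply/predeqP => x; split=> // -[Jx [i i17 /region]] => /(_ i17) [[_ Ox]|[_ Wx]|[_ Vx]].
  - exact: disjoint_mem JO Jx Ox.
  - exact: disjoint_mem JW Jx Wx.
  - exact: disjoint_mem JV Jx Vx.
have [||g [Gg _ gE]] := transport_tiles sG vG simG cT _ _ de de' cJ J0 JT JT'.
- by move=> i _; apply: Ge.
- by move=> i _; apply: Ge'.
exists g => // k x k17 Tx; have /andP[c9 c4] := cop _ k17; have /andP[k9 kk] := k17.
rewrite !gE //; last exact: lt9.
rewrite /e' (negPf c4) c9 !ifN -?leqNgt //; last by apply/eqP => k4; rewrite k4 in k9.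
by rewrite !homeoM homeoVK.
Qed.

End Placement.

(** * Generation *)

Section Generation.
Variables (G : set (homeo X)) (T q : set X) (c : homeo X) (E : nat -> homeo X).
Variables kap phi al : homeo X.
Hypotheses (sG : subgroup G) (vG : vigorous G) (simG : simple_group G).
Hypothesis fgG : finitely_generated G.
Hypotheses (cT : clopen T) (Gc : G c) (Tc : supported T c) (c3 : c ^+ 3 = 1).
Hypotheses (cq : clopen q) (q0 : q !=set0) (qT : q `<=` T).
Hypothesis qc : forall x, q x -> ~ q (c x) /\ ~ q (c (c x)).
Hypotheses (GE : forall i, G (E i)) (dE : disjoint_tiles T E 17) (R0 : Rest T E !=set0).
Hypotheses (Gk : G kap) (Gp : G phi) (Gal : G al).
Hypotheses (kE : permutes_tiles T E 17 kap17 kap) (pE : permutes_tiles T E 17 phi17 phi).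
Hypothesis alE : forall k x, (9 <= k < 17)%N -> T x -> al (E k x) = E (copied k) x.

Let lt17 i : (i < 9)%N -> (i < 17)%N.
Proof. by move=> i9; apply: ltn_trans i9 _. Qed.

Let copied_lt k : (9 <= k < 17)%N -> (copied k < 9)%N && (copied k != 4).
Proof. by do 17!(case: k => [|k] //). Qed.

Lemma kap_tiles9 : permutes_tiles T E 9 cycle5 kap.
Proof.
split=> [i x i9 Tx|].
  by rewrite kE.1 ?lt17 //; do 9!(case: i i9 => [|i] // i9).
apply: supportedS (kap_support kE) => x [i /andP[_ i5] Ti]; exists i => //.
exact: ltn_trans i5 _.
Qed.

(** The support of [phi] is in tiles 9 to 16, which [al] identifies with tiles 0 to 8 other than 4.
    Conjugation by [al] therefore transfers the swaps there and leaves tile 4 fixed. *)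
Lemma phi_al_tiles9 : permutes_tiles T E 9 swap4 (phi ^ al).
Proof.
have fixes y : ~ (exists2 k, (9 <= k < 17)%N & tile T E k y) -> phi y = y.
  move=> ny; apply: (phi_support pE) => -[k /andP[k17 k9] Tk].
  by apply: ny; exists k => //; rewrite k9.
split=> [i x i9 Tx|x nTx].
  rewrite homeoJ; have [i4|i4] := eqVneq i 4.
    rewrite fixes ?homeoVK; first by rewrite i4.
    move=> [k k17 /(imgP (E k))[y Ty ey]]; have /andP[c9 c4] := copied_lt k17.
    have Ti : tile T E i (E (copied k) y) by rewrite -alE // ey homeoVK; apply/imgE.
    have := dE (lt17 c9) (lt17 i9) ((imgE _ _ _).2 Ty) Ti.
    by rewrite i4 => e4; rewrite e4 in c4.
  have [k17 ck cp ckp] : [/\ (9 <= copy i < 17)%N, copied (copy i) = i,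
      (9 <= phi17 (copy i) < 17)%N & copied (phi17 (copy i)) = swap4 i].
    by do 9!(case: i i9 i4 => [|i] // i9 i4).
  have /andP[_ k17'] := k17.
  by rewrite -{1}ck -alE // homeoK pE.1 // alE // ckp.
rewrite homeoJ fixes ?homeoVK // => -[k k17 /(imgP (E k))[y Ty ey]]; apply: nTx.
exists (copied k); first by case/andP: (copied_lt k17).
by apply/imgP; exists y => //; rewrite -alE // ey homeoVK.
Qed.

Lemma al_tiles x : tiles T E 17 x -> ~ tiles T E 9 x -> tiles T E 9 (al x).
Proof.
move=> [k k17 /imgP[y Ty <-]] n9; have k9 : (9 <= k)%N.
  by rewrite leqNgt; apply/negP => k9; apply: n9; exists k => //; apply/imgE.
have k917 : (9 <= k < 17)%N by rewrite k9.
rewrite alE //; exists (copied k); first by case/andP: (copied_lt k917).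
exact/imgE.
Qed.

Let D : set X := Rest T E `|` img (E 5) T.

Let D_tile i x : (i < 17)%N -> i != 5 -> D x -> tile T E i x -> False.
Proof.
move=> i17 i5 [Rx|T5x] Tx; first by apply: Rx; exists i.
exact: (tile_disjoint dE i17 (isT : 5 < 17)%N i5 Tx T5x).
Qed.

(** Each factor of the conjugator meets the support of [chi] in a single slot: 5 for [psi], 7 for
    the copy of [s], 8 for the copy of [f]. Slot 6 is untouched. *)
Lemma conj_chi psi s f : supported D psi -> supported T s -> supported T f ->
  (chi c E) ^ (psi * s ^ E 7 * f ^ E 8) =
  (c ^ E 5) ^ psi * c ^ E 6 * (c ^ s) ^ E 7 * (c ^ f) ^ E 8.
Proof.
move=> Dpsi Ts Tf; rewrite /chi.
have D5 d : supported T d -> supported D (d ^ E 5).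
  by move=> dT; apply: supportedS (supportedJ dT) => x Tx; right.
have Dx1 : supported D ((c ^ E 5) ^ psi).
  by apply: (supported_conj (A := D)); [rewrite (img_supported Dpsi)|apply: D5].
have offD i d h : (i < 17)%N -> i != 5 -> supported T d -> supported D h ->
    (d ^ E i) ^ h = d ^ E i /\ h ^ (d ^ E i) = h.
  move=> i17 i5 dT hD; split.
    by apply: supported_conj_eq (supportedJ dT) hD _ => x Tx Dx; apply: D_tile Dx Tx.
  by apply: supported_conj_eq hD (supportedJ dT) _ => x Dx Tx; apply: D_tile Dx Tx.
have off i j d d' : (i < 17)%N -> (j < 17)%N -> i != j -> supported T d ->
    supported T d' -> (d ^ E i) ^ (d' ^ E j) = d ^ E i.
  move=> i17 j17 ij dT dT'; apply: supported_conj_eq (supportedJ dT) (supportedJ dT') _.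
  by move=> x; apply: (tile_disjoint dE i17 j17 ij).
have Tcs : supported T (c ^ s) by apply: (supported_conj _ Tc); rewrite (img_supported Ts).
have conj4 (x y z u g : homeo X) : (x * y * z * u) ^ g = x ^ g * y ^ g * z ^ g * u ^ g by rewrite !conjMg.
have conj3 (x u v w : homeo X) : x ^ (u * v * w) = ((x ^ u) ^ v) ^ w by rewrite !conjgM.
rewrite conj4 !conj3.
rewrite (offD 7 s _ _ _ _ Dx1).2 // (offD 8 f _ _ _ _ Dx1).2 //.
rewrite (offD 6 c _ _ _ _ Dpsi).1 // (offD 7 c _ _ _ _ Dpsi).1 // (offD 8 c _ _ _ _ Dpsi).1 //.
rewrite (off 6 7) // (off 6 8) // (off 8 7) // -!(conjJg c _ (E _)).
by rewrite (off 7 8).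
Qed.

(** Applied to [phi] and [kap], this shows that powers of beta yield these two elements
    themselves. *)
Lemma conj_off psi s f h (B : pred nat) : supported D psi -> supported T s -> supported T f ->
  ~~ B 5 -> ~~ B 7 -> ~~ B 8 ->
  supported [set x | exists2 i, (i < 17)%N && B i & tile T E i x] h ->
  h ^ (psi * s ^ E 7 * f ^ E 8) = h.
Proof.
move=> Dpsi Ts Tf B5 B7 B8 hB.
have off j d : (j < 17)%N -> ~~ B j -> supported T d -> h ^ (d ^ E j) = h.
  move=> j17 Bj dT; apply: supported_conj_eq hB (supportedJ dT) _ => x [i /andP[i17 Bi] Ti] Tj.
  by move: Bj; rewrite -(dE i17 j17 Ti Tj) Bi.
have conj3 (x u v w : homeo X) : x ^ (u * v * w) = ((x ^ u) ^ v) ^ w by rewrite !conjgM.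
rewrite conj3; have -> : h ^ psi = h; last by rewrite (off 7) // (off 8).
apply: supported_conj_eq hB Dpsi _ => x [i /andP[i17 Bi] Ti] Dx; apply: D_tile Dx Ti => //.
by apply: contraNneq B5 => <-.
Qed.

Lemma generation : exists2 d, G d &
  generated [set al; (phi * kap * chi c E) ^ d] = G.
Proof.
have kE9 := kap_tiles9; have pE9 := phi_al_tiles9; have dE9 := de9 dE.
have [s [Z [[Gs qs sZ] [cZ Z0 Zq]]]] := exists_shift sG vG cq q0.
have Ts : supported T s by apply: supportedS qs.
have cV := clopen_V c E cT cZ : clopen (V T c E Z).
have cZ1 : clopen (img (E 5) (Z1 c Z)) by do 2!apply: clopen_img.
have Z10 : img (E 5) (Z1 c Z) !=set0 by have [z Zz] := Z0; exists (E 5 (c z)); apply/imgE; rewrite /Z1 imgE.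
have [C [cC CZ1 C0 Z1C]] := clopen_split cZ1 Z10.
have Z1T5 : img (E 5) (Z1 c Z) `<=` img (E 5) T by apply: imgS; apply: (Z1T Tc qT Zq).
have VD : V T c E Z `|` img (E 5) (Z1 c Z) `<=` D.
  by move=> x [[Rx|[Tx _]]|/Z1T5 Tx]; [left|right|right].
have [|||||||k [Gkk kV kC]] := @vigorous_push G sG vG (V T c E Z `|` img (E 5) (Z1 c Z)) (V T c E Z) C => //.
- exact: clopenU.
- have [z Zz] := Z10; exists z; split; first by right.
  move=> [Rz|[_ nZ]]; last by apply: nZ; left; right.
  by apply: disjoint_mem (@Rest_tile T E 5 isT) (Z1T5 _ Zz) Rz.
- by move=> x /CZ1; right.
(* The push [k] compresses [V] into [C]; its inverse expands slot 5 over [V]. *)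
pose psi := k^-1.
have Gpsi : G psi by apply: subgroupV.
have psiV : supported (V T c E Z `|` img (E 5) (Z1 c Z)) psi by apply: supportedV.
have psiC x : V T c E Z x -> C (psi^-1 x) by apply: kC.
have Dpsi : supported D psi by apply: supportedS psiV.
pose x1 := (c ^ E 5) ^ psi.
have Dx1 : supported D x1.
  apply: (supported_conj (A := D)); first by rewrite (img_supported Dpsi).
  by apply: supportedS (supportedJ Tc) => x Tx; right.
have RT9 : Rest T E `&` tiles T E 9 = set0.
  apply/predeqP => x; split=> // -[Rx [i i9 Ti]].
  exact: disjoint_mem (@Rest_tile T E _ i9) Ti Rx.
pose gen0 := generated [set kap; phi ^ al].
(* This word sends tile 5 to tile 0 and fixes tiles 6, 7 and 8. Being a word in [kap] and
   [phi ^ al], its realisation lies in every subgroup containing these two. *)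
have [||||t t0 tE] := @exists_tile_word gen0 T E kap (phi ^ al)
    [:: true; false; false; false; false; true; false; true; false; true] (@generated_subgroup _ _) => //.
- by apply: sub_generated; left.
- by apply: sub_generated; right.
have sub0 K : subgroup K -> K kap -> K (phi ^ al) -> K t.
  by move=> sK Kk Kp; apply: (generated_sub sK _ t0) => h [->|->].
have Gt : G t by apply: sub0 => //; apply: subgroupJ.
have tT x : img (E 5) T x -> (x1 ^ t) x = x.
  move=> Tx; apply: (supportedJ (g := t) Dx1); rewrite imgU (img_Rest tE.2).
  rewrite (permutes_img tE) // => -[Rx|T0x].
    exact: disjoint_mem (@Rest_tile T E 5 isT) Tx Rx.
  exact: (tile_disjoint dE9 (isT : 5 < 9)%N (isT : 0 < 9)%N isT Tx T0x).
pose y := x1 * (x1^-1) ^ t.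
pose cc := c ^ E 6 * (c^-1) ^ E 0.
have Gx1 : G x1 by do 2!apply: subgroupJ => //.
pose base := [:: kap; phi ^ al; al; y; cc].
(* None of these generators involves [f], which is chosen only after finite generation has cut [S]
   down to a finite list [L]. *)
pose S := [set h | h \in base \/ exists u v, [/\ G u, G v, supported Z u, supported Z v &
                     h = [~ u, v] ^ E 0]].
have SG : S `<=` G.
  move=> h [|[u [v [Gu Gv _ _ ->]]]]; last by apply: subgroupJ => //; apply: subgroupR.
  rewrite !in_cons in_nil orbF => /or4P[/eqP->|/eqP->|/eqP->|/orP[/eqP->|/eqP->]] //.
  - exact: subgroupJ.
  - by apply: subgroupM => //; apply: subgroupJ => //; apply: subgroupV.
  - by apply: subgroupM => //; apply: subgroupJ => //; apply: subgroupV.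
have GS : generated S = G.
  apply/predeqP => h; split; first exact: (generated_sub sG SG).
  have base_gen g : g \in base -> generated S g by move=> gb; apply: sub_generated; left.
  apply: (absorb_all sG vG simG cT Tc c3 qT qc dE kE9 pE9 al_tiles (Z := Z) (psi := psi)
    (t := t) (C := C) (@generated_subgroup _ S)) => //; try by apply: base_gen; rewrite !in_cons eqxx ?orbT.
    exact: (generated_sub sG SG).
  move=> g /(commutators_inJ sG (subgroupV sG (GE 0))); rewrite imgK.
  move=> [u [v [Gu Gv uZ vZ e]]]; apply: sub_generated; right; exists u, v; split=> //.
  by rewrite -e conjgKV.
have [L LS GL] : exists2 L : seq (homeo X), {in L, forall h, S h} & G `<=` generated [set` L].
  by have := @finitely_generated_seq _ S; rewrite GS; apply.
have [U UP LU] : exists2 U, {in U, forall u, G u /\ supported Z u} &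
    {in L, forall h, h \in base \/ exists i j, [/\ (i < size U)%N, (j < size U)%N, i != j &
      h = [~ nth 1 U i, nth 1 U j] ^ E 0]}.
  elim: L LS {GL} => [_|h L IHL LS]; first by exists [::].
  have [|U UP LU] := IHL; first by move=> g gL; apply: LS; rewrite in_cons gL orbT.
  have [hb|[u [v [Gu Gv uZ vZ eh]]]] := LS h (mem_head _ _).
    by exists U => // g; rewrite in_cons => /orP[/eqP->|/LU//]; left.
  (* Each commutator in [L] contributes its own pair of entries, so its two indices are distinct;
     earlier indices move up by 2. *)
  exists [:: u, v & U] => [w|g]; first by rewrite !in_cons => /or3P[/eqP->|/eqP->|/UP].
  rewrite in_cons => /orP[/eqP->|/LU[|[i [j [iU jU ij eg]]]]].
  - by right; exists 0%N, 1%N.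
  - by left.
  - by right; exists i.+2, j.+2.
have [f [Gf qf fU]] := shifted_product sG Gs qs Zq sZ UP.
have Tf : supported T f by apply: supportedS qf.
pose d := psi * s ^ E 7 * f ^ E 8.
have GJ x i : G x -> G (x ^ E i) by move=> Gx; apply: subgroupJ.
have Gd : G d by apply: subgroupM => //; [apply: subgroupM => //|]; apply: GJ.
exists d => //; set beta := _ ^ d.
pose H := generated [set al; beta].
have sH : subgroup H by apply: generated_subgroup.
have Hal : H al by apply: sub_generated; left.
have Hbeta : H beta by apply: sub_generated; right.
have [p15 p6 p10] := sigma_powers Tc c3 dE kE pE.
have Hphi : H phi.
  have := subgroupX 15 sH Hbeta; rewrite /beta -conjXg p15.
  by rewrite (conj_off Dpsi Ts Tf _ _ _ (phi_support pE)).
have Hkap : H kap.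
  have := subgroupX 6 sH Hbeta; rewrite /beta -conjXg p6.
  by rewrite (conj_off Dpsi Ts Tf _ _ _ (kap_support kE)).
have Hchi : H (x1 * c ^ E 6 * (c ^ s) ^ E 7 * (c ^ f) ^ E 8).
  by have := subgroupX 10 sH Hbeta; rewrite /beta -conjXg p10 conj_chi.
have Hp : H (phi ^ al) by apply: (subgroupJ sH).
have Ht : H t by apply: (sub0 H sH).
have HG : H `<=` G.
  apply: generated_sub => // h [->|->] //; apply: subgroupJ => //.
  apply: subgroupM => //; first exact: subgroupM.
  by do 3![apply: subgroupM => //; last exact: GJ]; apply: GJ.
apply/predeqP => h; split; first exact: HG.
move=> /GL; apply: generated_sub => // g /LU[|[i [j [iU jU ij ->]]]].
  rewrite !in_cons in_nil orbF => /or4P[/eqP->|/eqP->|/eqP->|/orP[/eqP->|/eqP->]] //.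
    exact: (extract_x1 sH Tc qT qs qf Hchi Ht tE).
  exact: (extract_cc sH Tc qT qs qf dE9 Hkap Hp kE9 pE9 Dx1 RT9 Hchi).
apply: (extract_unshift sH Tc qT qc qs qf dE9 Hkap Hp kE9 pE9 Dx1 RT9 Hchi (n := 3 ^ i + 3 ^ j)).
  have UZ l : supported Z (nth 1 U l).
    have [lU|lU] := ltnP l (size U); last by rewrite nth_default.
    by have [] := UP _ (mem_nth 1 lU).
  by apply: supportedS Zq _; apply: supportedR.
rewrite -fU //.
exact: (extract_commutators sH Tc qT qc qs qf dE9 Hkap Hp kE9 pE9 Dx1 RT9 Hchi).
Qed.

End Generation.

Theorem theorem11 (G : set (homeo cantor_space))
    (G_subgroup : subgroup G)
    (G_fg : finitely_generated G)
    (G_simple : simple_group G)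
    (G_vigorous : vigorous G) :
  exists sigma : homeo cantor_space,
    [/\ G sigma, has_order sigma 30 &
        forall alpha : homeo cantor_space, G alpha -> alpha <> 1 ->
          exists beta : homeo cantor_space,
            conjugacy_class sigma G beta /\
            generated [set alpha; beta] = G].
Proof.
have [T [q [c [[cT T1 Gc Tc c3] [cq q0 qT qc]]]]] :=
  exists_three_cycle G_subgroup G_vigorous G_simple.
have [e [M [Ge de cM M0 MT]]] := exists_tiles G_subgroup G_vigorous 17 cT T1.
have Ge' i : (i < 17)%N -> G (e i) by [].
have T0 : T !=set0 by have [x qx] := q0; exists x; apply: qT.
have c1 : c <> 1.
  by move=> c1; have [x qx] := q0; have [] := qc x qx; rewrite c1.
(* A 5-cycle is conjugate to its square, hence is a commutator. *)
have [||kap Gk kE] := @permutes_tiles_commutator G G_subgroup G_vigorous G_simple T e 17 kap17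
  (nth 0 [:: 4; 0; 1; 2; 3; 5; 6; 7; 8; 9; 10; 11; 12; 13; 14; 15; 16])%N
  (nth 0 [:: 0; 2; 4; 1; 3; 5; 6; 7; 8; 9; 10; 11; 12; 13; 14; 15; 16])%N
  (nth 0 [:: 0; 3; 1; 4; 2; 5; 6; 7; 8; 9; 10; 11; 12; 13; 14; 15; 16])%N M cT Ge' de cM M0 MT.
- by do 17!(case=> [|i] //; move: i).
- by do 17!(case=> [|i] //; move: i).
have {}kE : permutes_tiles T e 17 kap17 kap.
  by apply: permutes_eq kE; do 17!(case=> [|i] //; move: i).
(* The product of four transpositions is the commutator of the product of two of
   them with an involution exchanging these two with the other two. *)
pose half := nth 0%N [:: 0; 1; 2; 3; 4; 5; 6; 7; 8; 13; 14; 11; 12; 9; 10; 15; 16]%N.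
pose swap := nth 0%N [:: 0; 1; 2; 3; 4; 5; 6; 7; 8; 11; 12; 9; 10; 15; 16; 13; 14]%N.
have [||phi Gp pE] := @permutes_tiles_commutator G G_subgroup G_vigorous G_simple T e 17
  half half swap swap M cT Ge' de cM M0 MT.
- by do 17!(case=> [|i] //; move: i).
- by do 17!(case=> [|i] //; move: i).
have {}pE : permutes_tiles T e 17 phi17 phi.
  by apply: permutes_eq pE; do 17!(case=> [|i] //; move: i).
have GcJ i : G (c ^ e i) by apply: subgroupJ.
exists (phi * kap * chi c e); split.
- apply: subgroupM => //; first exact: subgroupM.
  by do 3!apply: subgroupM => //.
- exact: sigma_order Tc c3 T0 de kE pE c1.
move=> al Gal al1.
have [g Gg gE] := placement G_subgroup G_vigorous G_simple cT Ge de cM M0 MT Gal al1.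
pose E i := e i * g.
have dE : disjoint_tiles T E 17.
  by move=> i j x i17 j17; rewrite /tile !imgM; apply: de.
have R0 : Rest T E !=set0.
  have [m Mm] := M0; exists (g m) => -[i i17]; rewrite /tile imgM imgE => Ti.
  by apply: disjoint_mem MT Mm _; exists i.
have [d Gd gen] := @generation G T q c E (kap ^ g) (phi ^ g) al G_subgroup G_vigorous G_simple
  G_fg cT Gc Tc c3 cq q0 qT qc (fun i => subgroupM G_subgroup (Ge i) Gg) dE R0
  (subgroupJ G_subgroup Gk Gg) (subgroupJ G_subgroup Gp Gg) Gal
  (permutes_translate g kE) (permutes_translate g pE) gE.
exists ((phi * kap * chi c e) ^ (g * d)); split.
  by exists (g * d) => //; apply: subgroupM.
rewrite -gen; congr (generated [set al; _]).
have conj3 x y z : (x * y * z) ^ g = x ^ g * y ^ g * z ^ g by rewrite !conjMg.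
have conj4 x y z u : (x * y * z * u) ^ g = x ^ g * y ^ g * z ^ g * u ^ g by rewrite !conjMg.
by rewrite conjgM conj3 /chi conj4 /E -!(conjgM c).
Qed.
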